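(* Let $k\geq 2$ be an integer. For all integers $n\geq 2k^{2}-k+2$, $$ar(n, kC_{3})=\left\lfloor\frac{(n-k+2)^{2}}{4}\right\rfloor+(k-2)(n-k+2)+\binom{k-2}{2}+1.$$
   Context: An edge-coloring of a graph assigns a color to each edge; an edge-colored graph is rainbow if all colors on its edges are distinct. For a positive integer $n$ and a graph $F$, the anti-Ramsey number $ar(n,F)$ is the maximum number of colors in an edge-coloring of the complete graph $K_n$ containing no rainbow copy of $F$. $kC_3$ denotes the graph consisting of $k$ vertex-disjoint triangles. *)

(* Defs.v *)
From mathcomp Require Import all_boot.

Set Implicit Arguments.
Unset Strict Implicit.
Unset Printing Implicit Defensive.

Record sgraph := SGraph {
  vertex :> finType;
  adj : rel vertex;
  adj_sym : symmetric adj;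
  adj_irrefl : irreflexive adj }.

Definition edges (G : sgraph) : {set {set G}} :=
  [set [set p.1; p.2] | p : G * G & adj p.1 p.2].

Section Complete.
Variable n : nat.
Definition complete_adj : rel 'I_n := fun x y => x != y.
Fact complete_sym : symmetric complete_adj.
Proof. by move=> x y; rewrite /complete_adj eq_sym. Qed.
Fact complete_irrefl : irreflexive complete_adj.
Proof. by move=> x; rewrite /complete_adj eqxx. Qed.
Definition complete := SGraph complete_sym complete_irrefl.
End Complete.

Section DisjointCopies.
Variables (k : nat) (F : sgraph).
Definition copies_adj : rel ('I_k * F)%type :=
  fun u v => (u.1 == v.1) && adj u.2 v.2.
Fact copies_sym : symmetric copies_adj.
Proof. by move=> u v; rewrite /copies_adj eq_sym adj_sym. Qed.
Fact copies_irrefl : irreflexive copies_adj.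
Proof. by move=> u; rewrite /copies_adj adj_irrefl andbF. Qed.
Definition disjoint_copies := SGraph copies_sym copies_irrefl.
End DisjointCopies.

Definition C3 : sgraph := complete 3.
Definition kC3 (k : nat) : sgraph := disjoint_copies k C3.

(* Colorings are total on {set G}; only their values on [edges G] are used.   *)
Definition coloring (G : sgraph) (C : finType) := {ffun {set G} -> C}.

Definition num_colors (G : sgraph) (C : finType) (c : coloring G C) : nat :=
  #|[set c e | e in edges G]|.

(* The copy of F is the (not necessarily induced) image of F under f.         *)
Definition rainbow_copy (F G : sgraph) (C : finType) (c : coloring G C)
    (f : {ffun F -> G}) : bool :=
  [&& injectiveb f,
      [forall x, forall y, adj x y ==> adj (f x) (f y)] &
      dinjectiveb (fun e : {set F} => c (f @: e)) (mem (edges F))].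

Definition has_rainbow (F G : sgraph) (C : finType) (c : coloring G C) : bool :=
  [exists f : {ffun F -> G}, rainbow_copy c f].

(* A palette with one color per edge loses no generality: see [ar_max].       *)
Definition ar (n : nat) (F : sgraph) : nat :=
  \max_(c : coloring (complete n) 'I_#|edges (complete n)|
         | ~~ has_rainbow F c) num_colors c.

Lemma ar_max (n : nat) (F : sgraph) (C : finType)
    (c : coloring (complete n) C) :
  ~~ has_rainbow F c -> num_colors c <= ar n F.
Proof.
move=> nc; set E := edges (complete n).
have [-> //|] := posnP (num_colors c).
rewrite /num_colors -/E card_gt0 => /set0Pn[a0 a0P].
pose S := [set c e | e in E].
have leSE : #|S| <= #|E| by apply: leq_imset_card.
pose r (a : C) : 'I_#|E| := widen_ord leSE (enum_rank_in a0P a).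
have rI : {in S &, injective r}.
  move=> a b aS bS /(congr1 val) /= /val_inj ab.
  exact: (can_in_inj (enum_rankK_in a0P)) ab.
pose c' : coloring (complete n) 'I_#|E| := [ffun e => r (c e)].
have imc' : [set c' e | e in E] = r @: S.
  apply/setP=> b; apply/imsetP/imsetP => [[e eE ->]|[a /imsetP[e eE ->] ->]].
    by exists (c e); [apply: imset_f | rewrite ffunE].
  by exists e; rewrite ?ffunE.
have <- : num_colors c' = #|S| by rewrite /num_colors imc' card_in_imset.
apply: (leq_bigmax_cond (F := fun c => num_colors c)).
apply: contra nc => /existsP[f /and3P[f1 f2 f3]]; apply/existsP; exists f.
apply/and3P; split=> //; apply/dinjectiveP => e e' eE e'E cee'.
by move/dinjectiveP: f3; apply=> //=; rewrite !ffunE cee'.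
Qed.

Lemma ar_attained (n : nat) (F : sgraph) :
  (exists (C : finType) (c : coloring (complete n) C), ~~ has_rainbow F c) ->
  exists (C : finType) (c : coloring (complete n) C),
    ~~ has_rainbow F c /\ num_colors c = ar n F.
Proof.
move=> [C [c nc]].
have [ar0|] := posnP (ar n F).
  exists C, c; split=> //; apply/eqP; rewrite eqn_leq ar_max //=.
  by rewrite ar0.
move=> ar_gt0; pose N := #|edges (complete n)|.
have [/eqP P0|P_gt0] :=
    eqVneq #|[pred c : coloring (complete n) 'I_N | ~~ has_rainbow F c]| 0.
  by move: ar_gt0; rewrite /ar big_pred0 // => c'; apply: (fintype.pred0P P0).
rewrite -lt0n in P_gt0.
have [c1 c1P arE] := eq_bigmax_cond (fun c => num_colors c) P_gt0.
by exists 'I_N, c1; split; [exact: c1P | rewrite /ar -arE].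
Qed.

(* Main.v *)
(* Suppose a colouring without rainbow kC3 uses two colours more than the graph
   K_(k-2) v T_2(n-k+2) has edges (this graph coloured injectively, with one further colour
   elsewhere, is the extremal colouring). Choose a rainbow graph G with exactly that many edges.
   Adding a nonedge aa' to G and deleting a suitable edge g gives another rainbow graph.

   By induction on k some G contains a set F of k-1 disjoint triangles; choose F so that its
   complement W spans as many edges as possible. W is triangle-free. If a, a' in W have two common
   neighbours in W, the edge g exchanged for aa' must lie inside some t in F, and then no vertex of
   t forms a triangle with an edge of W avoiding a, a'. Such pairs exist outside any set of 2(k-1)
   vertices. Call t flat if none of its vertices forms a triangle with an edge of W. Counting edges
   shows that F has at most one flat triangle, and a pair a, a' avoiding one edge of W for each
   other triangle shows that it has one, T. Choosing a, a' cleverly then shows that G is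
   triangle-free on W + T up to one edge of T and that few edges join the triangles of F; adding
   up, G has too few edges.

   For k = 2 one inducts on n: a vertex of degree at most n/2 can be deleted, and otherwise the
   exchange argument applies to a single triangle. The case n = 7 is a computation. *)

Require Import Defs.
From mathcomp Require Import all_boot.
From mathcomp Require Import zify.

Set Implicit Arguments.
Unset Strict Implicit.
Unset Printing Implicit Defensive.

(** * Neighbourhoods and Mantel's theorem *)

Section Graphs.
Variable V : finType.
Implicit Types (G : {set {set V}}) (x y z u v w : V) (A B : {set V}).

Definition gadj G : rel V := fun x y => (x != y) && ([set x; y] \in G).

Lemma gadjC G x y : gadj G x y = gadj G y x.
Proof. by rewrite /gadj eq_sym setUC. Qed.

Lemma gadj_neq G x y : gadj G x y -> x != y.
Proof. by case/andP. Qed.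

Definition nb G A x : {set V} := [set w in A | gadj G x w].
Definition dg G A x := #|nb G A x|.
(* Counts ordered pairs: [eo G A A] is twice the number of edges inside [A]. *)
Definition eo G A B := \sum_(x in A) dg G B x.

Lemma in_nb G A x w : (w \in nb G A x) = (w \in A) && gadj G x w.
Proof. by rewrite in_set. Qed.

Lemma dgE G A x : dg G A x = \sum_(w in A) gadj G x w.
Proof.
rewrite /dg -sum1_card (eq_bigl (fun w => (w \in A) && gadj G x w)); last first.
  by move=> w; rewrite inE.
by rewrite big_mkcondr /=; apply: eq_bigr => w _; case: gadj.
Qed.

Lemma eoC G A B : eo G A B = eo G B A.
Proof.
rewrite /eo (eq_bigr (fun x => \sum_(w in B) gadj G x w)) => [|x _]; last exact: dgE.
rewrite exchange_big /=; apply: eq_bigr => w _; rewrite dgE.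
by apply: eq_bigr => x _; rewrite gadjC.
Qed.

Lemma eoUl G A1 A2 B : [disjoint A1 & A2] -> eo G (A1 :|: A2) B = eo G A1 B + eo G A2 B.
Proof.
move=> d; rewrite /eo -bigU //=; apply: eq_bigl => x; by rewrite !inE.
Qed.

Lemma eoUr G A B1 B2 : [disjoint B1 & B2] -> eo G A (B1 :|: B2) = eo G A B1 + eo G A B2.
Proof. by move=> d; rewrite !(eoC G A) eoUl. Qed.

Lemma dg_leq G A x : dg G A x <= #|A|.
Proof. by apply: subset_leq_card; apply/subsetP => w; rewrite inE => /andP[]. Qed.

Lemma eo_leq G A B : eo G A B <= #|A| * #|B|.
Proof. by rewrite -sum_nat_const; apply: leq_sum => x _; exact: dg_leq. Qed.

Lemma dgS G A B x : A \subset B -> dg G A x <= dg G B x.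
Proof.
move=> /subsetP s; apply: subset_leq_card; apply/subsetP => w; rewrite !inE => /andP[/s -> ->] //.
Qed.

(** Handshake count: the ordered adjacent pairs are sorted by the edge they span, and each edge
    arises from exactly two of them. *)
Lemma eo_card G : (forall e, e \in G -> #|e| = 2) -> 2 * #|G| = eo G setT setT.
Proof.
move=> G2.
have -> : eo G setT setT = \sum_(p : V * V | gadj G p.1 p.2) 1.
  rewrite -(pair_big_dep xpredT (fun x y => gadj G x y) (fun _ _ => 1)) /= /eo.
  rewrite (eq_bigl xpredT) => [|x]; last by rewrite inE.
  apply: eq_bigr => x _; rewrite dgE big_mkcond [RHS]big_mkcond /=.
  by apply: eq_bigr => w _; rewrite inE; case: gadj.
rewrite (partition_big (fun p : V * V => [set p.1; p.2]) (mem G)) /=; last first.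
  by move=> [x y] /= /andP[].
rewrite -[#|G|]sum1_card big_distrr /=; apply: eq_bigr => e eG.
have /eqP/cards2P[x [y [xy def]]] := G2 _ eG.
rewrite sum1_card (_ : #|_| = #|[set (x, y); (y, x)]|).
  by rewrite cards2 xpair_eqE negb_and xy.
apply: eq_card => -[p q]; rewrite !inE /= !xpair_eqE unfold_in /=.
apply/andP/orP => [[/andP[pq _] /eqP]|].
  rewrite def => E.
  have: p \in [set x; y] by rewrite -E !inE eqxx.
  have: q \in [set x; y] by rewrite -E !inE eqxx orbT.
  rewrite !inE => /orP[]/eqP eq /orP[]/eqP ep; subst; rewrite ?eqxx in pq *; rewrite ?eqxx;
    by [right|left|].
by case=> /andP[/eqP-> /eqP->]; rewrite /gadj ?(eq_sym y) xy /= ?(setUC [set y]) -def eG eqxx.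
Qed.

Definition indep G A := [forall x in A, forall y in A, ~~ gadj G x y].

Lemma indepP G A : reflect (forall x y, x \in A -> y \in A -> ~~ gadj G x y) (indep G A).
Proof.
apply: (iffP forall_inP) => [h x y xA yA|h x xA]; first by have /forall_inP := h x xA; apply.
by apply/forall_inP => y yA; apply: h.
Qed.

Definition trifree G A := forall x y z, x \in A -> y \in A -> z \in A ->
  gadj G x y -> gadj G x z -> gadj G y z -> False.

Lemma nb_indep G A x : trifree G A -> x \in A -> indep G (nb G A x).
Proof.
move=> tf xA; apply/indepP => y z; rewrite !inE => /andP[yA xy] /andP[zA xz].
by apply/negP => yz; apply: tf xy xz yz.
Qed.

(** Every edge inside [A] has an end outside [I], so the degrees summed over [A :\: I] already count
    each edge at least once. *)
Lemma eo_indep G A (I : {set V}) : I \subset A -> indep G I -> (forall v, v \in A -> dg G A v <= #|I|) ->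
  eo G A A <= 2 * (#|I| * (#|A| - #|I|)).
Proof.
move=> sI /indepP iI dI.
have defA : A = I :|: (A :\: I) by rewrite -{1}(setID A I) (setIidPr sI).
have dis : [disjoint I & A :\: I] by rewrite -setI_eq0; apply/eqP/setP => x; rewrite !inE; case:
  (x \in I).
have cD : #|A :\: I| = #|A| - #|I| by rewrite cardsD (setIidPr sI).
have e1 : eo G I A <= eo G (A :\: I) A.
  rewrite {1}defA eoUr // [eo G I I]big1 => [|x xI]; last first.
    by apply/eqP; rewrite cards_eq0; apply/eqP/setP => w; rewrite !inE; case wI: (w \in I);
      rewrite //= (negPf (iI _ _ xI wI)).
  rewrite add0n eoC; apply: leq_sum => x _; exact: dgS.
have e2 : eo G (A :\: I) A <= (#|A| - #|I|) * #|I|.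
  rewrite -cD -sum_nat_const; apply: leq_sum => x; rewrite inE => /andP[_]; exact: dI.
rewrite {1}defA eoUl //; lia.
Qed.

(** The neighbourhood of a vertex of maximum degree is independent, and no degree exceeds its size;
    AM-GM bounds the resulting product. *)
Lemma mantel G A : trifree G A -> 2 * eo G A A <= #|A| ^ 2.
Proof.
move=> tf; have [->|[x0 x0A]] := set_0Vmem A; first by rewrite /eo big_set0.
case: (@arg_maxnP V x0 (mem A) (dg G A) x0A) => x xA xmax.
have := @eo_indep G A (nb G A x) _ (nb_indep tf xA) (fun v vA => xmax v vA).
have s : nb G A x \subset A by apply/subsetP => w; rewrite inE => /andP[].
move=> /(_ s) le; have cle := subset_leq_card s.
have := nat_AGM2 #|nb G A x| (#|A| - #|nb G A x|); rewrite subnKC // => h.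
by apply: leq_trans h; rewrite -[4]/(2 * 2) -mulnA leq_pmul2l.
Qed.

End Graphs.

(** * Triangle packings and rainbow graphs *)

Section Packings.
Variable V : finType.
Implicit Types (G F : {set {set V}}) (x y z u v w : V) (t e : {set V}).

Definition tri G t :=
  (#|t| == 3) && [forall x in t, forall y in t, (x != y) ==> gadj G x y].

Lemma triP G t : tri G t ->
  forall x y, x \in t -> y \in t -> x != y -> gadj G x y.
Proof. by case/andP => _ /forall_inP h x y xt yt xy; have /forall_inP/(_ y yt)/implyP := h x xt;
  apply. Qed.

Lemma tri3 G x y z :
  gadj G x y -> gadj G x z -> gadj G y z -> tri G [set x; y; z].
Proof.
move=> xy xz yz; apply/andP; split.
  by rewrite -setUA !cardsU1 cards1 !inE negb_or (gadj_neq xy) (gadj_neq xz) (gadj_neq yz).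
by apply/forall_inP => p; rewrite !inE => /orP[/orP[]|] /eqP->; apply/forall_inP => q;
  rewrite !inE => /orP[/orP[]|] /eqP->; rewrite ?eqxx ?xy ?xz ?yz ?implybT //= gadjC ?xy ?xz ?yz implybT.
Qed.

Lemma tri_del G t (g : {set V}) : tri G t -> ~~ (g \subset t) -> tri (G :\ g) t.
Proof.
move=> tt gt; case/andP: (tt) => t3 _; rewrite /tri t3 /=.
apply/forall_inP => x xt; apply/forall_inP => y yt; apply/implyP => xy.
have /andP[_ xyG] := triP tt xt yt xy.
rewrite /gadj xy !inE xyG andbT /=; apply: contraNneq gt => <-.
by apply/subsetP => p; rewrite !inE => /orP[]/eqP->.
Qed.

Definition lab t x y z := [/\ t = [set x; y; z], x != y, x != z & y != z].

Lemma labC t x y z : lab t x y z -> lab t x z y.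
Proof. by case=> -> xy xz yz; split; rewrite 1?(eq_sym z) // setUAC. Qed.

Lemma labR t x y z : lab t x y z -> lab t y z x.
Proof.
by case=> -> xy xz yz; split; rewrite // 1?(eq_sym _ x) // -setUA setUC.
Qed.

Lemma tri_lab G t x : tri G t -> x \in t -> exists y z, lab t x y z.
Proof.
case/andP => /eqP t3 _ xt; have := cardsD1 x t; rewrite xt t3 => -[] /esym/eqP/cards2P[y [z [yz E]]].
exists y, z; have : y \in t :\ x by rewrite E !inE eqxx.
have : z \in t :\ x by rewrite E !inE eqxx orbT.
rewrite !inE => /andP[zx zt] /andP[yx yt]; split; rewrite // 1?eq_sym //.
by rewrite -(setD1K xt) E setUA.
Qed.

Lemma lab_in t x y z : lab t x y z -> [/\ x \in t, y \in t & z \in t].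
Proof. by case=> -> _ _ _; rewrite !inE !eqxx !orbT. Qed.

Lemma tri_ex G t : tri G t -> exists x y z, lab t x y z.
Proof.
move=> tt; have /card_gt0P[x xt] : 0 < #|t| by case/andP: tt => /eqP->.
by exists x; apply: tri_lab tt xt.
Qed.

Lemma lab_adj G t x y z : tri G t -> lab t x y z -> [/\ gadj G x y, gadj G x z & gadj G y z].
Proof.
move=> tt l; have [xt yt zt] := lab_in l; case: l => _ xy xz yz.
by split; apply: (triP tt).
Qed.

Lemma dg_lab (G : {set {set V}}) A t x y z : lab t x y z -> eo G t A = dg G A x + dg G A y + dg G A z.
Proof.
by case=> -> xy xz yz; rewrite /eo -setUA !big_setU1 ?big_set1 /= ?addnA // !inE ?negb_or ?xy.
Qed.

Definition packing G F := trivIset F && [forall t in F, tri G t].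

Lemma packing_tri G F t : packing G F -> t \in F -> tri G t.
Proof. by case/andP => _ /forall_inP h /h. Qed.

Lemma packing_disj G F s t : packing G F -> s \in F -> t \in F -> s != t -> [disjoint s & t].
Proof. by case/andP => /trivIsetP h _; apply: h. Qed.

Lemma packing_sub G G' F F' : packing G F -> F' \subset F ->
  (forall t, t \in F' -> tri G' t) -> packing G' F'.
Proof.
case/andP => tF _ s h; rewrite /packing (trivIsetS s tF) /=; exact/forall_inP.
Qed.

Lemma packing_add G F t : packing G F -> tri G t -> [disjoint t & cover F] ->
  packing G (t |: F) /\ #|t |: F| = #|F|.+1.
Proof.
move=> pF tt d.
have t0 : t != set0 by rewrite -card_gt0; case/andP: tt => /eqP->.
have tF : t \notin F.
  apply: contraNN t0 => tF; move: d; rewrite -setI_eq0 (setIidPl _) //; exact: bigcup_sup.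
split; last by rewrite cardsU1 tF.
rewrite /packing; apply/andP; split; last first.
  by apply/forall_inP => s; rewrite !inE => /orP[/eqP->|/(packing_tri pF)].
apply/trivIsetP => A B; rewrite !inE => /orP[/eqP->|AF] /orP[/eqP->|BF]; rewrite ?eqxx //.
- by move=> _; apply: disjointWr d; apply: bigcup_sup.
- by move=> _; rewrite disjoint_sym; apply: disjointWr d; apply: bigcup_sup.
- exact: (packing_disj pF).
Qed.

Lemma packing_cover G F : packing G F -> #|cover F| = 3 * #|F|.
Proof.
move=> pF; have /andP[/eqP<- _] := pF.
rewrite (eq_bigr (fun=> 3)) => [|t /(packing_tri pF)/andP[/eqP->] //].
by rewrite sum_nat_const mulnC.
Qed.

Lemma packing0 G : packing G set0.
Proof. by apply/andP; split; [apply/trivIsetP => ? ?; rewrite inE|apply/forall_inP => ?;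
  rewrite inE]. Qed.

Lemma cover_del F t : trivIset F -> t \in F -> cover (F :\ t) = cover F :\: t.
Proof.
move=> tF tin; apply/setP => x; rewrite inE; apply/bigcupP/andP.
  case=> s; rewrite !inE => /andP[st sF] xs; split; last by apply/bigcupP; exists s.
  have /trivIsetP/(_ s t sF tin st) := tF; rewrite -setI_eq0 => /eqP/setP/(_ x).
  by rewrite !inE xs /= => ->.
case=> xt /bigcupP[s sF xs]; exists s; rewrite // !inE sF andbT.
by apply: contraNneq xt => <-.
Qed.

Lemma coverU1 F t : cover (t |: F) = t :|: cover F.
Proof.
apply/setP => x; rewrite inE; apply/bigcupP/orP.
  by case=> s; rewrite !inE => /orP[/eqP->|sF] xs; [left|right; apply/bigcupP; exists s].
by case=> [xt|/bigcupP[s sF xs]]; [exists t|exists s]; rewrite ?inE ?eqxx ?sF ?orbT.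
Qed.

Lemma disjoint3 x y z (S : {set V}) :
  [disjoint [set x; y; z] & S] = [&& x \notin S, y \notin S & z \notin S].
Proof. by rewrite disjoints_subset !subUset !sub1set !in_setC -andbA. Qed.

(** * Rainbow graphs and the exchange of edges *)

Section Coloring.
Variables (C : finType) (c : {set V} -> C).

Definition rain G := (forall e, e \in G -> #|e| = 2) /\ {in G &, injective c}.

Lemma rain_sub G G' : rain G -> G' \subset G -> rain G'.
Proof. by move=> [h1 h2] /subsetP s; split => [e /s /h1 //|e f /s eG /s fG]; apply: h2. Qed.

(** As [G] is rainbow, at most one of its edges has the colour of [e], and [g] is that edge; if
    there is none, any edge of the nonempty [G] serves. *)
Lemma exchange G e : rain G -> 0 < #|G| -> #|e| = 2 -> e \notin G ->
  exists2 g, g \in G & rain (e |: (G :\ g)).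
Proof.
move=> [G2 Gi] /card_gt0P[g0 g0G] e2 eG.
have [g gG hg] : exists2 g, g \in G & forall f, f \in G :\ g -> c f != c e.
  case: (boolP [exists g in G, c g == c e]) => [/exists_inP[g gG /eqP cg]|/exists_inPn h].
    by exists g => // f; rewrite !inE => /andP[fg fG]; apply: contraNneq fg; rewrite -cg => /Gi->.
  by exists g0 => // f; rewrite !inE => /andP[_ /h].
exists g => //; split => [f|f f']; rewrite !in_setU1.
  by case/orP => [/eqP->|] //; rewrite inE => /andP[_ /G2].
case/orP => [/eqP->|fG]; case/orP => [/eqP->|fG'] // E.
- by have := hg _ fG'; rewrite E eqxx.
- by have := hg _ fG; rewrite E eqxx.
by move: fG fG'; rewrite !inE => /andP[_ fG] /andP[_ fG']; apply: Gi.
Qed.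

(** The absence of a rainbow kC3, stated with packings in place of embeddings. *)
Definition noP k := forall G F, rain G -> packing G F -> #|F| < k.

Definition ncol := #|c @: [set e : {set V} | #|e| == 2]|.

(** While the graph has fewer edges than there are colours, some colour is missing from it, and an
    edge of that colour can be added. *)
Lemma rain_ext G0 m : rain G0 -> #|G0| <= m <= ncol -> exists2 G, rain G & G0 \subset G /\ #|G| = m.
Proof.
move=> r0 /andP[]; move: {2}(m - #|G0|) (erefl (m - #|G0|)) => d.
elim: d G0 r0 => [|d IH] G0 r0 dE le lm.
  by exists G0 => //; split=> //; lia.
have [e e2 ce] : exists2 e : {set V}, #|e| == 2 & c e \notin c @: G0.
  have : ~~ (c @: [set e : {set V} | #|e| == 2] \subset c @: G0).
    apply: contraTN (_ : #|G0| < ncol) => [s|]; last by lia.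
    by rewrite -leqNgt (leq_trans (subset_leq_card s)) // leq_imset_card.
  by case/subsetPn => a /imsetP[e]; rewrite inE => e2 ->; exists e.
have eG : e \notin G0 by apply: contraNN ce => eG; apply: imset_f.
have [||||G rG [s Gm]] := IH (e |: G0).
- case: r0 => h1 h2; split => [f|f f']; rewrite !in_setU1.
    by case/orP => [/eqP->|/h1 //]; apply/eqP.
  case/orP => [/eqP->|fG]; case/orP => [/eqP->|fG'] // E; last exact: h2.
  + by case/negP: ce; rewrite E imset_f.
  + by case/negP: ce; rewrite -E imset_f.
- by rewrite cardsU1 eG; lia.
- by rewrite cardsU1 eG; lia.
- by [].
by exists G => //; split=> //; apply: subset_trans s; apply: subsetUr.
Qed.

Lemma rain_ex m : m <= ncol -> exists2 G, rain G & #|G| = m.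
Proof.
move=> h; have [||G rG [_ Gm]] := @rain_ext set0 m; last by exists G.
  by split=> [e|e f]; rewrite inE.
by rewrite cards0.
Qed.

End Coloring.
End Packings.

Lemma imset_set3 (V V' : finType) (f : V' -> V) x y z : f @: [set x; y; z] = [set f x; f y; f z].
Proof. by rewrite !imsetU !imset_set1. Qed.

(** * Pulling a colouring back along an injection *)

Section Transfer.
Variables (V V' C : finType) (f : V' -> V) (c : {set V} -> C).
Hypothesis fI : injective f.
Let c' (e : {set V'}) := c (f @: e).
Implicit Types (G F : {set {set V'}}) (x y : V').

Lemma rain_img G : rain c' G -> rain c [set f @: e | e : {set V'} in G].
Proof.
move=> [h1 h2]; split => [_ /imsetP[e eG ->]|_ _ /imsetP[a aG ->] /imsetP[b bG ->] E].
  by rewrite card_imset // h1.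
by rewrite (h2 _ _ aG bG E).
Qed.

Lemma gadj_img G x y : gadj [set f @: e | e : {set V'} in G] (f x) (f y) = gadj G x y.
Proof.
rewrite /gadj (inj_eq fI); congr (_ && _).
rewrite -!imset_set1 -imsetU mem_imset //; exact: imset_inj.
Qed.

Lemma packing_img G F : packing G F ->
  packing [set f @: e | e : {set V'} in G] [set f @: t | t : {set V'} in F].
Proof.
move=> pF; apply/andP; split.
  apply/trivIsetP => _ _ /imsetP[s sF ->] /imsetP[t tF ->] st.
  rewrite imset_disjoint //.
  by apply: (packing_disj pF) => //; apply: contraNneq st => ->.
apply/forall_inP => _ /imsetP[t tF ->].
have tt := packing_tri pF tF; have [x [y [z l]]] := tri_ex tt.
have [xy xz yz] := lab_adj tt l; case: l => -> _ _ _.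
by rewrite imset_set3; apply: tri3; rewrite gadj_img.
Qed.

Lemma noP_img k : noP c k -> noP c' k.
Proof.
move=> h G F rG pF; have := h _ _ (rain_img rG) (packing_img pF).
rewrite card_imset //; exact: imset_inj.
Qed.

End Transfer.

Lemma card_ge2P (T : finType) (A : {set T}) : 1 < #|A| -> exists a b, [/\ a \in A, b \in A & a != b].
Proof. by move=> /card_gt1P[a [b [? ? ?]]]; exists a, b. Qed.

(** * Exchanging triangles *)

Section PackingSurgery.
Variable V : finType.
Implicit Types (G F : {set {set V}}) (x y z u v w : V) (t e A B : {set V}).

Lemma trifree_dec G A : trifree G A \/ exists x y z,
  [/\ x \in A, y \in A & z \in A] /\ [/\ gadj G x y, gadj G x z & gadj G y z].
Proof.
case: (boolP [exists x in A, exists y in A, exists z in A, [&& gadj G x y, gadj G x z & gadj G y z]]).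
  case/exists_inP => x xA /exists_inP[y yA /exists_inP[z zA /and3P[xy xz yz]]].
  by right; exists x, y, z.
move=> no; left => x y z xA yA zA xy xz yz; case/negP: no.
apply/exists_inP; exists x => //; apply/exists_inP; exists y => //; apply/exists_inP; exists z => //.
by rewrite xy xz yz.
Qed.

Lemma dgU G A B x : [disjoint A & B] -> dg G (A :|: B) x = dg G A x + dg G B x.
Proof. by move=> d; have := eoUr G [set x] d; rewrite /eo !big_set1. Qed.

Lemma disjointC A : [disjoint A & ~: A].
Proof. by rewrite disjoints_subset setCK. Qed.

Lemma dgT G A x : dg G setT x = dg G A x + dg G (~: A) x.
Proof. by rewrite -(setUCr A) dgU ?disjointC. Qed.

Lemma dg_trifree G A u v : trifree G A -> u \in A -> v \in A -> gadj G u v ->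
  dg G A u + dg G A v <= #|A|.
Proof.
move=> tf uA vA uv; rewrite -cardsUI [X in _ + X]eq_card0 ?addn0.
  by apply: subset_leq_card; apply/subsetP => w; rewrite !inE => /orP[] /andP[].
by move=> w; rewrite !inE; apply/negP => /andP[/andP[wA uw] /andP[_ vw]]; apply: tf uv uw vw.
Qed.

Lemma dg_common G A u v : #|A| < dg G A u + dg G A v ->
  exists2 x, x \in A & gadj G u x && gadj G v x.
Proof.
move=> h; have : 0 < #|nb G A u :&: nb G A v|.
  have := cardsUI (nb G A u) (nb G A v); rewrite -/(dg G A u) -/(dg G A v) => E.
  have : #|nb G A u :|: nb G A v| <= #|A|.
    by apply: subset_leq_card; apply/subsetP => w; rewrite !inE => /orP[] /andP[].
  lia.
by case/card_gt0P => x; rewrite !inE => /andP[/andP[xA ux] /andP[_ vx]]; exists x; rewrite ?ux ?vx.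
Qed.

Lemma dg3 G t x y z w : lab t x y z -> dg G t w = gadj G w x + gadj G w y + gadj G w z.
Proof.
by case=> -> xy xz yz; rewrite dgE -setUA !big_setU1 ?big_set1 /= ?addnA // !inE ?negb_or ?xy.
Qed.

Lemma trans_packing G G' F t : packing G F -> t \in F ->
  (forall s, s \in F -> s != t -> tri G' s) ->
  [/\ packing G' (F :\ t), #|F :\ t|.+1 = #|F| & cover (F :\ t) = cover F :\: t].
Proof.
move=> pF tF h; have /andP[tr _] := pF; split; first 1 last.
- by rewrite (cardsD1 t F) tF.
- exact: cover_del.
by apply: (packing_sub pF); rewrite ?subsetDl // => s; rewrite !inE => /andP[st sF]; apply: h.
Qed.

Lemma packing_delg G F t (g : {set V}) : packing G F -> t \in F -> g \subset t -> g != set0 ->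
  forall s, s \in F -> s != t -> tri (G :\ g) s.
Proof.
move=> pF tF gt g0 s sF st; apply: tri_del (packing_tri pF sF) _.
apply: contraNN g0 => gs; rewrite -subset0; apply/subsetP => x xg; move: (packing_disj pF sF tF st).
by rewrite -setI_eq0 => /eqP<-; rewrite inE (subsetP gs) ?(subsetP gt).
Qed.

Lemma packing_push G F t : packing G F -> tri G t -> [disjoint t & cover F] ->
  exists F', [/\ packing G F', #|F'| = #|F|.+1 & cover F' = t :|: cover F].
Proof.
move=> pF tt d; have [h1 h2] := packing_add pF tt d.
by exists (t |: F); rewrite coverU1.
Qed.

Lemma in_cover F x t : t \in F -> x \in t -> x \in cover F.
Proof. by move=> tF xt; apply/bigcupP; exists t. Qed.

Lemma gadj_del G (g : {set V}) x y : gadj G x y -> ~~ (x \in g) || ~~ (y \in g) -> gadj (G :\ g) x y.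
Proof.
move=> /andP[xy xyG] h; rewrite /gadj xy !inE xyG andbT /=.
by apply: contraTneq h => <-; rewrite !inE !eqxx orbT.
Qed.

Lemma gadj_neqg G (g : {set V}) x y : gadj G x y -> g != [set x; y] -> gadj (G :\ g) x y.
Proof. by move=> /andP[xy xyG] h; rewrite /gadj xy !inE xyG andbT eq_sym. Qed.

Variables (C : finType) (c : {set V} -> C) (k : nat).
Hypothesis NP : noP c k.
Variables (G F : {set {set V}}).
Hypotheses (rG : rain c G) (pF : packing G F) (Fk : #|F|.+1 = k).
Let W := ~: cover F.

Lemma W_trifree : trifree G W.
Proof.
move=> x y z; rewrite !in_setC => xW yW zW xy xz yz.
have [||F' [pF' cF' _]] := @packing_push G F [set x; y; z] pF; first exact: tri3.
  by rewrite disjoint3 xW yW zW.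
by have := NP rG pF'; rewrite cF' Fk ltnn.
Qed.

Lemma two_for_one t t1 t2 : t \in F -> tri G t1 -> tri G t2 -> [disjoint t1 & t2] ->
  [disjoint t1 & cover F :\: t] -> [disjoint t2 & cover F :\: t] -> False.
Proof.
move=> tF T1 T2 d12 d1 d2.
have [|pF0 cF0 vF0] := @trans_packing G G F t pF tF.
  by move=> s sF _; apply: packing_tri pF sF.
have [|F1 [pF1 cF1 vF1]] := @packing_push G (F :\ t) t1 pF0 T1; first by rewrite vF0.
have [|F2 [pF2 cF2 _]] := @packing_push G F1 t2 pF1 T2.
  rewrite vF1 vF0 disjoints_subset setCU subsetI -!disjoints_subset d2 andbT.
  by rewrite disjoint_sym.
by have := NP rG pF2; rewrite cF2 cF1 cF0 Fk ltnn.
Qed.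

(** Otherwise the triangles [xuv] and [yzw] would be disjoint and could together replace [t]. *)
Lemma apex_unique_common t x y z u v w : t \in F -> lab t x y z -> u \in W -> v \in W -> w \in W ->
  gadj G u v -> gadj G x u -> gadj G x v -> gadj G y w -> gadj G z w -> (w == u) || (w == v).
Proof.
rewrite !in_setC => tF l uW vW wW uv xu xv yw zw; apply/negPn/negP; rewrite negb_or => /andP[wu wv].
have [xt yt zt] := lab_in l; have [_ _ yz] := lab_adj (packing_tri pF tF) l.
have nW p q : p \in t -> q \notin cover F -> p != q.
  by move=> pt; apply: contraNneq => <-; apply: in_cover pt.
case: (l) => _ xy xz _.
apply: (@two_for_one t [set x; u; v] [set y; z; w]) => //; first exact: tri3.
- exact: tri3.
- rewrite disjoint3 !inE !negb_or xy xz (nW x w) // ![u == _]eq_sym ![v == _]eq_sym wu wv.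
  by rewrite !nW.
- by rewrite disjoint3 !inE xt (negPf uW) (negPf vW) !andbF.
- by rewrite disjoint3 !inE yt zt (negPf wW) !andbF.
Qed.

(* The edge exchanged for the new edge aa' must lie in a triangle of F: otherwise aa'b or aa'b'
   completes F. Being inside t, it no longer obstructs packings that replace t. *)
Lemma rich_exchange a a' b b' :
  a \in W -> a' \in W -> b \in W -> b' \in W -> a != a' -> b != b' ->
  gadj G a b -> gadj G a' b -> gadj G a b' -> gadj G a' b' ->
  exists (g t : {set V}), [/\ g \in G, t \in F, g \subset t, g != set0 &
    forall F2, packing (G :\ g) F2 -> #|F2| = #|F| -> a \notin cover F2 -> a' \notin cover F2 ->
      (b \notin cover F2) || (b' \notin cover F2) -> False].
Proof.
move=> aW a'W bW b'W aa' bb' ab a'b ab' a'b'.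
have naa' : [set a; a'] \notin G.
  apply/negP => h; apply: (W_trifree aW a'W bW) => //; by rewrite /gadj aa'.
have G0 : 0 < #|G| by apply/card_gt0P; exists [set a; b]; case/andP: ab.
have [|g gG rG'] := exchange rG G0 _ naa'; first by rewrite cards2 aa'.
(* If [g] is neither [aq] nor [a'q], then [aa'q] is a triangle of the exchanged graph, and it would
   extend [F2] to [k] triangles. *)
have main F2 q : packing (G :\ g) F2 -> #|F2| = #|F| -> a \notin cover F2 -> a' \notin cover F2 ->
    q \notin cover F2 -> gadj G a q -> gadj G a' q -> g != [set a; q] -> g != [set a'; q] -> False.
  move=> pF2 cF2 aF a'F qF aq a'q ga ga'.
  have up x y : gadj (G :\ g) x y -> gadj ([set a; a'] |: (G :\ g)) x y.
    by case/andP=> xy h; rewrite /gadj xy in_setU1 h orbT.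
  have pF3 : packing ([set a; a'] |: (G :\ g)) F2.
    apply: (packing_sub pF2) => // t tF2; have tt := packing_tri pF2 tF2.
    case/andP: (tt) => t3 _; rewrite /tri t3; apply/forall_inP => x xt; apply/forall_inP => y yt.
    by apply/implyP => xy; apply: up; apply: (triP tt).
  have [||F' [pF' cF' _]] := @packing_push _ F2 [set a; a'; q] pF3.
  - apply: tri3; first by rewrite /gadj aa' in_setU1 eqxx.
      by apply: up; apply: gadj_neqg.
    by apply: up; apply: gadj_neqg.
  - by rewrite disjoint3 aF a'F qF.
  by have := NP rG' pF'; rewrite cF' cF2 Fk ltnn.
have g2 : #|g| = 2 by case: rG => h _; apply: h.
have g0 : g != set0 by rewrite -card_gt0 g2.
case: (boolP [exists t in F, g \subset t]) => [/exists_inP[t tF gt]|/exists_inPn no].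
  have ng p q : p \in W -> g != [set p; q].
    rewrite in_setC; apply: contraNneq => gE; apply: (in_cover tF); apply: (subsetP gt).
    by rewrite gE !inE eqxx.
  exists g, t; split=> // F2 pF2 cF2 aF a'F /orP[bF|bF].
    by apply: (main F2 b); rewrite ?ng.
  by apply: (main F2 b'); rewrite ?ng.
(* Here [g] lies inside no triangle of [F], so [F] survives its deletion. If [g] is [ab] or [a'b]
   then it misses [b'], so [b] or [b'] always completes the extra triangle. *)
have pF2 : packing (G :\ g) F.
  by apply: (packing_sub pF) => // t tF; apply: tri_del (packing_tri pF tF) (no t tF).
have aF : a \notin cover F by rewrite -in_setC.
have a'F : a' \notin cover F by rewrite -in_setC.
exfalso; have [E|E] := boolP ((g == [set a; b]) || (g == [set a'; b])); last first.
  by move: E; rewrite negb_or => /andP[? ?]; apply: (main F b) => //; rewrite -in_setC.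
have b'g : b' \notin g.
  have := gadj_neq ab'; have := gadj_neq a'b'; rewrite ![_ == b']eq_sym => h1 h2.
  by case/orP: E => /eqP->; rewrite !inE negb_or ?h1 ?h2 /= eq_sym.
apply: (main F b') => //; rewrite -?in_setC //; apply: contraNneq b'g => ->; by rewrite !inE eqxx orbT.
Qed.

(** Such a triangle [xuv] could replace [t] without using [g]. The new packing misses [a] and [a'],
    and it cannot cover both [b] and [b']: these would be [u] and [v], making [auv] a triangle
    inside [W]. *)
Lemma rich_apex a a' b b' :
  a \in W -> a' \in W -> b \in W -> b' \in W -> a != a' -> b != b' ->
  gadj G a b -> gadj G a' b -> gadj G a b' -> gadj G a' b' ->
  exists (g t : {set V}), [/\ g \in G, t \in F, g \subset t,
    forall F2, packing (G :\ g) F2 -> #|F2| = #|F| -> a \notin cover F2 -> a' \notin cover F2 ->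
      (b \notin cover F2) || (b' \notin cover F2) -> False &
    forall x u v, x \in t -> u \in W -> v \in W -> gadj G u v ->
    gadj G x u -> gadj G x v -> u != a -> u != a' -> v != a -> v != a' -> False].
Proof.
move=> aW a'W bW b'W aa' bb' ab a'b ab' a'b'.
have [g [t [gG tF gt g0 h]]] := rich_exchange aW a'W bW b'W aa' bb' ab a'b ab' a'b'.
exists g, t; split=> // x u v xt uW vW uv xu xv ua ua' va va'.
have [|pF0 cF0 vF0] := @trans_packing G (G :\ g) F t pF tF; first exact: (packing_delg pF).
have notg p : p \in W -> p \notin g.
  rewrite in_setC; apply: contraNN => pg; apply: (in_cover tF); exact: (subsetP gt).
have xW p : p \in W -> p != x.
  by rewrite in_setC; apply: contraNneq => ->; apply: in_cover xt.
have out p : p \in W -> p != u -> p != v -> p \notin [set x; u; v] :|: cover F :\: t.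
  by move=> pW pu pv; rewrite !inE !negb_or xW // pu pv /=; move: pW; rewrite in_setC => /negPf->;
    rewrite andbF.
have [||F1 [pF1 cF1 vF1]] := @packing_push _ (F :\ t) [set x; u; v] pF0.
- by apply: tri3; apply: gadj_del; rewrite ?(notg u) ?(notg v) ?orbT.
- by rewrite vF0 disjoint3 !inE xt; move: uW vW; rewrite !in_setC => /negPf-> /negPf->; rewrite !andbF.
apply: (h F1) => //; first by rewrite cF1.
- by rewrite vF1 vF0 out // eq_sym.
- by rewrite vF1 vF0 out // eq_sym.
rewrite vF1 vF0.
have bbad q q' : q \in W -> q' \in W -> q != q' -> gadj G a q -> gadj G a q' ->
    q \in [set x; u; v] :|: cover F :\: t -> q' \in [set x; u; v] :|: cover F :\: t -> False.
  move=> qW q'W qq' aq aq'; rewrite !inE (negPf (xW _ qW)) (negPf (xW _ q'W)).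
  move: (qW) (q'W); rewrite !in_setC => /negPf-> /negPf->; rewrite !andbF !orbF /=.
  move=> /orP[]/eqP E /orP[]/eqP E'; subst q q'; rewrite ?eqxx // in qq'.
    by apply: (W_trifree aW uW vW).
  by apply: (W_trifree aW vW uW) => //; rewrite gadjC.
by rewrite -negb_and; apply/negP => /andP[]; apply: bbad.
Qed.

End PackingSurgery.

(** * The case n = 7, k = 2 *)

(* A graph on seven vertices is a sequence of 21 bits indexed by [edges7], and [masks7] lists the
   copies of 2C3. Sorting the edges by larger endpoint puts the triangle 012 first; it may be
   assumed to be in the graph, and 11 of the other 18 edges are to be chosen. *)
Definition edges7 : seq (nat * nat) := [seq (i, j) | j <- iota 0 7, i <- iota 0 j].
Definition sides (t : seq nat) : seq (nat * nat) :=
  if t is [:: a; b; c] then [:: (a, b); (a, c); (b, c)] else [::].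
Definition triangles7 : seq (seq nat) :=
  [seq [:: e.1; e.2; c] | c <- iota 0 7, e <- [seq e <- edges7 | e.2 < c]].
Definition disjoint_pairs7 : seq (seq nat * seq nat) :=
  [seq p <- [seq (t, t') | t <- triangles7, t' <- triangles7] | uniq (p.1 ++ p.2) &&
    (head 0 p.1 < head 0 p.2)].
Definition masks7 : seq bitseq :=
  [seq [seq (e \in sides p.1 ++ sides p.2) | e <- edges7] | p <- disjoint_pairs7].

(* [||], [&&], [has] and [all] evaluate both operands under [vm_compute]. *)
Section ShortCircuit.
Variables (T : Type) (p : pred T).
Fixpoint has_if s := if s is x :: s' then (if p x then true else has_if s') else false.
Fixpoint all_if s := if s is x :: s' then (if p x then all_if s' else false) else true.
Lemma has_ifE s : has_if s = has p s.
Proof. by elim: s => //= x s ->; case: (p x). Qed.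
Lemma all_ifE s : all_if s = all p s.
Proof. by elim: s => //= x s ->; case: (p x). Qed.
End ShortCircuit.

Fixpoint subb (m s : bitseq) : bool :=
  match m, s with
  | b :: m', b' :: s' => if b then (if b' then subb m' s' else false) else subb m' s'
  | _, _ => true
  end.

Definition flip (s : bitseq) i j := set_nth false (set_nth false s i true) j false.

Section Search.
Variables (M : seq bitseq) (depth : nat).

(* [refute] succeeds if [s] contains 2C3, or if for some nonedge [i] every graph obtained by
   exchanging an edge for [i] is refuted with one exchange fewer. *)
Fixpoint refute d (s : bitseq) : bool :=
  if has_if (subb^~ s) M then true else
  if d is d'.+1 then
     has_if (fun i => if nth false s i then false else
       all_if (fun j => if nth false s j then refute d' (flip s i j) else true) (iota 0 21)) (iota 0 21)
  else false.

(** Bits are decided one at a time: [acc] holds the decided ones, [cnt] is the number of true bits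
    still to be placed, and [ms] holds the undecided tails of the masks that [acc] satisfies. A tail
    without true bits means that a copy of 2C3 is already present. *)
Fixpoint search n cnt (acc : bitseq) (ms : seq bitseq) : bool :=
  if has_if (all_if negb) ms then true else
  if n is n'.+1 then
     if (if cnt is cnt'.+1 then search n' cnt' (rcons acc true) [seq behead m | m <- ms] else true)
     then (if cnt > n' then true
           else search n' cnt (rcons acc false) [seq behead m | m <- ms & ~~ head false m])
     else false
  else if cnt > 0 then true else refute depth acc.

Lemma subb_nth m s i : subb m s -> i < size s -> nth false m i -> nth false s i.
Proof.
elim: m s i => [|b m IH] [|b' s] [|i] //=; first by case: b; case: b'.
by case: b; case: b' => //; apply: IH.
Qed.

Lemma subb_neg m s : all negb m -> subb m s.
Proof. by elim: m s => [|b m IH] [|b' s] //= /andP[/negPf-> /IH]. Qed.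

Lemma search_sound n cnt acc ms : search n cnt acc ms -> forall s, size s = n -> count id s = cnt ->
  (exists2 m, m \in ms & subb m s) \/ refute depth (acc ++ s).
Proof.
elim: n cnt acc ms => [|n IH] cnt acc ms /=; rewrite has_ifE; case: ifP => [|_].
- by move=> /hasP[m mm]; rewrite all_ifE => h _ s _ _; left; exists m => //; apply: subb_neg.
- by move=> h s /size0nil->; case: cnt h => //= h _; right; rewrite cats0.
- by move=> /hasP[m mm]; rewrite all_ifE => h _ s _ _; left; exists m => //; apply: subb_neg.
case: ifP => // h1 h2 [|[] s] //= [sn] cn.
  case: cnt cn h1 h2 => // cnt; rewrite add1n => -[cn] h1 _.
  case: (IH _ _ _ h1 s sn cn) => [[_ /mapP[m mm ->] sm]|]; last by rewrite cat_rcons; right.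
  by left; exists m => //; case: m mm sm => [|[] m].
case: ltnP h2 => [lt _|_ h2]; first by have := count_size id s; rewrite add0n in cn; lia.
case: (IH _ _ _ h2 s sn cn) => [[_ /mapP[m mm ->] sm]|]; last by rewrite cat_rcons; right.
move: mm; rewrite mem_filter => /andP[hm mm].
by left; exists m => //; case: m hm mm sm => [|[] m].
Qed.

Lemma refuteE d s : refute d s = if has_if (subb^~ s) M then true else
  if d is d'.+1 then
     has_if (fun i => if nth false s i then false else
       all_if (fun j => if nth false s j then refute d' (flip s i j) else true) (iota 0 21)) (iota 0 21)
  else false.
Proof. by case: d. Qed.

Lemma refute_all s : search 18 11 [:: true; true; true] [seq drop 3 m | m <- M] ->
  size s = 18 -> count id s = 11 -> refute depth (true :: true :: true :: s).
Proof.
move=> st s18 s11; case: (search_sound st s18 s11) => // -[_ /mapP[m mm ->] sm].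
rewrite refuteE has_ifE; case: hasP => // -[]; exists m => //.
by case: m sm {mm} => [|[] [|[] [|[] m]]] //=; rewrite drop0.
Qed.

End Search.

(** At most two exchanges refute every graph with 14 edges that contains the triangle 012 but no
    2C3. *)
Lemma search_true : search masks7 2 18 11 [:: true; true; true] [seq drop 3 m | m <- masks7].
Proof. by vm_compute. Qed.

Lemma disjoint_pairs7_ok : all (fun p => [&& size p.1 == 3, size p.2 == 3, uniq (p.1 ++ p.2),
  all (fun i => i < 7) (p.1 ++ p.2) & all (fun e =>
    e \in edges7) (sides p.1 ++ sides p.2)]) disjoint_pairs7.
Proof. by vm_compute. Qed.

Lemma edges7_uniq : uniq edges7. Proof. by vm_compute. Qed.

Lemma edges7_lt : all (fun p => p.1 < p.2 < 7) edges7. Proof. by vm_compute. Qed.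

Lemma size_edges7 : size edges7 = 21. Proof. by vm_compute. Qed.

Lemma mem_edges7 i j : i < j -> j < 7 -> (i, j) \in edges7.
Proof. by move=> ij j7; apply/allpairsPdep; exists j, i; rewrite !mem_iota; split=> //; lia. Qed.

Lemma masks7E : masks7 = [seq [seq (e \in sides p.1 ++ sides p.2) | e <- edges7] | p <- disjoint_pairs7].
Proof. by []. Qed.

Opaque edges7 disjoint_pairs7 masks7.

Section SevenVertices.
Variables (V C : finType) (c : {set V} -> C).
Hypothesis NP : noP c 2.
Variable f : nat -> V.
Hypothesis fI : forall i j, i < 7 -> j < 7 -> f i = f j -> i = j.

Definition edge i : {set V} := let p := nth (0, 0) edges7 i in [set f p.1; f p.2].
Definition Gs (s : bitseq) : {set {set V}} :=
  [set e | has (fun i => nth false s i && (e == edge i)) (iota 0 21)].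

Lemma edge_inj i j : i < 21 -> j < 21 -> edge i = edge j -> i = j.
Proof.
have uE := edges7_uniq; have /allP lE := edges7_lt; rewrite -size_edges7 => i21 j21; rewrite /edge.
have := lE _ (mem_nth (0, 0) i21); have := lE _ (mem_nth (0, 0) j21).
case Ei: (nth _ _ i) => [a b]; case Ej: (nth _ _ j) => [a' b'] /= lj li E.
suff /eqP : nth (0, 0) edges7 i = nth (0, 0) edges7 j by rewrite nth_uniq // => /eqP.
rewrite Ei Ej.
have : f a \in [set f a'; f b'] by rewrite -E !inE eqxx.
have : f b \in [set f a'; f b'] by rewrite -E !inE eqxx orbT.
move: lj li => /andP[ab' b'7] /andP[ab b7].
have a7 := ltn_trans ab b7; have a'7 := ltn_trans ab' b'7.
rewrite !inE => /orP[]/eqP Eb /orP[]/eqP Ea; move: ab.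
- by rewrite (fI b7 a'7 Eb) (fI a7 a'7 Ea) ltnn.
- by rewrite (fI b7 a'7 Eb) (fI a7 b'7 Ea) ltnNge (ltnW ab').
- by rewrite (fI b7 b'7 Eb) (fI a7 a'7 Ea).
- by rewrite (fI b7 b'7 Eb) (fI a7 b'7 Ea) ltnn.
Qed.

Lemma edge_Gs s i : i < 21 -> (edge i \in Gs s) = nth false s i.
Proof.
move=> i21; rewrite inE; apply/hasP/idP => [[j]|si]; last by exists i; rewrite ?mem_iota ?si ?eqxx.
by rewrite mem_iota => j21 /andP[sj /eqP/edge_inj E]; rewrite E.
Qed.

Lemma subb_sound m s : m \in masks7 -> subb m s -> size s = 21 -> rain c (Gs s) -> False.
Proof.
rewrite masks7E => /mapP[[t t'] pT mE] sm s21 rG.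
have /allP/(_ _ pT)/and5P[] := disjoint_pairs7_ok; have /allP lE := edges7_lt.
case: t pT mE => [|a [|b [|d [|]]]] // pT mE _; case: t' pT mE => [|a' [|b' [|d' [|]]]] // pT mE _.
rewrite [_.1 ++ _]/= => up /and5P[a7 b7 d7 a'7 /and3P[b'7 d'7 _]] /allP inE7.
have adj p q : (p, q) \in sides [:: a; b; d] ++ sides [:: a'; b'; d'] -> gadj (Gs s) (f p) (f q).
  move=> pq; have pqE := inE7 _ pq; have /= /andP[lpq q7] := lE _ pqE.
  have i21 : index (p, q) edges7 < 21 by rewrite -size_edges7 index_mem.
  apply/andP; split; first by apply/eqP => /fI E; lia.
  have := edge_Gs s i21; rewrite /edge nth_index //= => ->.
  by apply: subb_nth sm _ _; rewrite ?s21 // mE (nth_map (0, 0)) ?nth_index ?index_mem.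
have ne i j : i != j -> i < 7 -> j < 7 -> f i != f j.
  by move=> ij i7 j7; apply: contraNneq ij => /fI->.
have [||F1 [pF1 cF1 vF1]] := @packing_push _ (Gs s) set0 [set f a; f b; f d] (packing0 _).
- by apply: tri3; apply: adj; rewrite !inE eqxx ?orbT.
- by rewrite /cover big_set0 disjoint3 !inE.
have [||F2 [pF2 cF2 vF2]] := @packing_push _ (Gs s) F1 [set f a'; f b'; f d'] pF1.
- by apply: tri3; apply: adj; rewrite !inE eqxx ?orbT.
- rewrite vF1 /cover big_set0 setU0 disjoint3 !inE !negb_or.
  move: up; rewrite /= !inE !negb_or !andbT =>
    /and5P[/and5P[? ? ? ? ?] /and4P[? ? ? ?] /and3P[? ? ?] _ _].
  by rewrite !(eq_sym (f a')) !(eq_sym (f b')) !(eq_sym (f d')) !ne.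
by have := NP rG pF2; rewrite cF2 cF1 cards0.
Qed.

(** Adding the nonedge [i] forces out an edge [j] that is not known in advance, hence the quantifier
    over all [j]. The flipped graph lies inside the one given by [exchange], so it is rainbow. *)
Lemma refute_sound d s : size s = 21 -> refute masks7 d s -> 0 < #|Gs s| -> rain c (Gs s) -> False.
Proof.
have /allP lE := edges7_lt.
elim: d s => [|d IH] s s21; rewrite refuteE has_ifE; case: ifP => [/hasP[m mM sm] _ _|_] //.
- exact: subb_sound sm s21.
- exact: subb_sound sm s21.
rewrite has_ifE => /hasP[i]; rewrite mem_iota => i21.
case si: (nth false s i) => //; rewrite all_ifE => /allP h G0 rG.
have eG : edge i \notin Gs s by rewrite edge_Gs ?si.
have e2 : #|edge i| = 2.
  rewrite /edge cards2; case: eqP => // /fI E.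
  rewrite -size_edges7 in i21; have /= /andP[e12 e7] := lE _ (mem_nth (0, 0) i21).
  by move: (e12); rewrite (E (ltn_trans e12 e7) e7) ltnn.
have [g gG rG'] := exchange rG G0 e2 eG.
move: (gG); rewrite inE => /hasP[j]; rewrite mem_iota => j21 /andP[sj /eqP gE].
have := h j; rewrite mem_iota sj => /(_ j21) hr.
have ij : i != j by apply: contraTneq sj => <-; rewrite si.
apply: (IH (flip s i j)) => //.
- by rewrite /flip !size_set_nth s21; lia.
- apply/card_gt0P; exists (edge i); rewrite edge_Gs // /flip nth_set_nth /= (negPf ij).
  by rewrite nth_set_nth /= eqxx.
apply: rain_sub rG' _; apply/subsetP => e; rewrite inE => /hasP[l]; rewrite mem_iota =>
  l21 /andP[sl /eqP->].
move: sl; rewrite /flip nth_set_nth /=; case: eqP => // lj; rewrite nth_set_nth /=.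
rewrite in_setU1 in_setD1; case: eqP => [->|li sl]; first by rewrite eqxx.
rewrite edge_Gs // sl andbT gE; apply/orP; right.
by apply: contra_notN lj => /eqP/edge_inj ->.
Qed.
End SevenVertices.

Lemma card_has (T : finType) (g : nat -> T) n (p : pred nat) :
  {in gtn n &, injective g} ->
  #|[set e | has (fun i => p i && (e == g i)) (iota 0 n)]| = count p (iota 0 n).
Proof.
move=> gI; rewrite -size_filter -(size_map g).
have /card_uniqP<- : uniq (map g (filter p (iota 0 n))).
  rewrite map_inj_in_uniq ?filter_uniq ?iota_uniq // => i j.
  by rewrite !mem_filter !mem_iota => /andP[_ ?] /andP[_ ?]; apply: gI.
apply: eq_card => e; rewrite inE; apply/hasP/mapP.
  by case=> i il /andP[pi /eqP->]; exists i => //; rewrite mem_filter pi.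
by case=> i; rewrite mem_filter => /andP[pi il] ->; exists i; rewrite ?pi ?eqxx.
Qed.

Lemma count_nth (s : bitseq) : count id s = count (nth false s) (iota 0 (size s)).
Proof. by rewrite -{1}(mkseq_nth false s) count_map; apply: eq_count. Qed.

Lemma no_rainbow_on_seven (V C : finType) (c : {set V} -> C) G : noP c 2 -> #|V| = 7 -> rain c G ->
  #|G| = 14 -> False.
Proof.
move=> NP V7 rG G14; have [G2 _] := rG.
have [tf|[x [y [z [_ [xy xz yz]]]]]] := trifree_dec G setT.
  (* A triangle-free graph on 7 vertices has at most 12 edges. *)
  by have := mantel tf; rewrite -eo_card // cardsT V7 G14.
(* The known triangle is listed first, so that 01, 02 and 12, the first three entries of [edges7],
   are edges of [G]. *)
pose r := [:: x, y, z & enum (~: [set x; y; z])].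
have t3 : #|[set x; y; z]| = 3 by have /andP[/eqP] := tri3 xy xz yz.
have ur : uniq r.
  rewrite /r /= !inE !mem_enum !inE !eqxx ?orbT /= !negb_or enum_uniq.
  by rewrite (gadj_neq xy) (gadj_neq xz) (gadj_neq yz).
have sr : size r = 7 by rewrite /= -cardE cardsCs setCK t3 V7.
pose f i := nth x r i.
have fI i j : i < 7 -> j < 7 -> f i = f j -> i = j.
  by rewrite -sr => i7 j7 /eqP; rewrite nth_uniq // => /eqP.
have fS p : exists2 i, i < 7 & p = f i.
  have pr : p \in r.
    by rewrite !inE mem_enum !inE; do 3! case: (_ == _) => //=.
  by exists (index p r); rewrite ?/f ?nth_index // -sr index_mem.
pose s := [seq [set f p.1; f p.2] \in G | p <- edges7].
have s21 : size s = 21 by rewrite size_map size_edges7.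
have sN i : i < 21 -> nth false s i = (edge f i \in G).
  by rewrite -size_edges7 => i21; rewrite (nth_map (0, 0)).
have GE : Gs f s = G.
  apply/setP => e; rewrite inE; apply/hasP/idP => [[i]|eG].
    by rewrite mem_iota => i21; rewrite sN // => /andP[h /eqP->].
  have /eqP/cards2P[p [q [pq eE]]] := G2 _ eG.
  have [i i7 pE] := fS p; have [j j7 qE] := fS q.
  have [a [b [ab b7 eE']]] : exists a b, [/\ a < b, b < 7 & e = [set f a; f b]].
    case: (ltngtP i j) => ij; first by exists i, j; rewrite eE pE qE.
      by exists j, i; rewrite eE pE qE setUC.
    by rewrite pE qE ij eqxx in pq.
  have abE := mem_edges7 ab b7.
  exists (index (a, b) edges7); first by rewrite mem_iota -size_edges7 index_mem.
  rewrite sN; last by rewrite -size_edges7 index_mem.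
  by rewrite /edge nth_index //= -eE' eG eqxx.
have cs : count id s = 14.
  rewrite -G14 -GE card_has; last by move=> i j; rewrite !inE; apply: edge_inj.
  by rewrite count_nth s21.
have [s' sE] : exists s', s = true :: true :: true :: s'.
  have h0 : nth false s 0 by rewrite sN //; case/andP: xy.
  have h1 : nth false s 1 by rewrite sN //; case/andP: xz.
  have h2 : nth false s 2 by rewrite sN //; case/andP: yz.
  case: (s) s21 h0 h1 h2 => [|[] [|[] [|[] s']]] //; by exists s'.
apply: (refute_sound NP fI s21 (d := 2)); rewrite ?GE ?G14 //.
rewrite sE; apply: refute_all search_true _ _.
  by move: s21; rewrite sE => -[].
by move: cs; rewrite sE /= => -[].
Qed.

(** * The case k = 2 *)

(* [lia] turns every boolean hypothesis into a case split, so the irrelevant ones are dropped. *)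
Ltac slia := intros; repeat match goal with
  | H : is_true ?b |- _ => lazymatch b with leq _ _ => fail | _ => clear H end
  end; lia.

Section Two.
Variables (V C : finType) (c : {set V} -> C) (G : {set {set V}}).
Hypotheses (NP : noP c 2) (V8 : 8 <= #|V|) (rG : rain c G).
Hypothesis (deg : forall v, #|V| %/ 2 < dg G setT v).
Hypothesis G_gt : #|V| ^ 2 < 4 * #|G|.

(** The degree condition makes every edge of the triangle-free [W] send at least four edges to the
    triangle [T], so its ends have a common neighbour in [T]. This forces enough complete bipartite
    structure on [W] to contradict [rich_apex]. *)
Lemma min_degree_two : False.
Proof.
have [tf|[x0 [y0 [z0 [_ [xy0 xz0 yz0]]]]]] := trifree_dec G setT.
  by have := mantel tf; case: rG => G2 _; rewrite -eo_card // cardsT; lia.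
have [d Vd degd] : exists2 d, #|V| <= 2 * d + 1 & forall v, d < dg G setT v.
  by exists (#|V| %/ 2) => //; lia.
clear G_gt deg.
have [T TE] : exists T, T = [set x0; y0; z0] by eexists.
have TT : tri G T by rewrite TE; apply: tri3.
have [||F [pF F1 vF]] := @packing_push _ G set0 T (packing0 _) => //.
  by rewrite /cover big_set0 TE disjoint3 !inE.
rewrite cards0 in F1; rewrite /cover big_set0 setU0 -/(cover F) in vF.
have Fk : #|F|.+1 = 2 by rewrite F1.
have TF : T \in F.
  have /cards1P[t Ft] : #|F| == 1 by rewrite F1.
  by move: vF; rewrite Ft /cover big_set1 => <-; rewrite inE.
have [W WE] : exists W, W = ~: cover F by eexists.
have tfW : trifree G W by rewrite WE; apply: (W_trifree NP).
have f3 := apex_unique_common NP rG pF Fk; have ra := rich_apex NP rG pF Fk; rewrite -WE in f3 ra.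
have cT : #|T| = 3 by case/andP: TT => /eqP.
have cW : #|W| + 3 = #|V| by rewrite WE vF -cT addnC cardsC.
have degW v : d < dg G T v + dg G W v by rewrite WE vF -dgT.
have dT v : dg G T v <= 3 by rewrite -cT dg_leq.
have W2 v : 1 < dg G W v by have := degW v; have := dT v; slia.
have edgeT u v : u \in W -> v \in W -> gadj G u v ->
    #|V| + 1 <= dg G T u + dg G T v + (dg G W u + dg G W v) /\ 4 <= dg G T u + dg G T v.
  by move=> uW vW uv; have := dg_trifree tfW uW vW uv; have := degW u; have := degW v; slia.
have common u v : u \in W -> v \in W -> gadj G u v -> exists2 x, x \in T & gadj G u x && gadj G v x.
  by move=> uW vW uv; apply: dg_common; rewrite cT; have [_] := edgeT u v uW vW uv.
(* With [x] the common neighbour of [u] and [v] in [T], no other vertex of [W] is adjacent to both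
   remaining vertices of [T], so each sends at most two edges to [T]. *)
have le4 u v u' v' : u \in W -> v \in W -> gadj G u v -> u' \in W -> v' \in W ->
    u' != u -> u' != v -> v' != u -> v' != v -> dg G T u' + dg G T v' <= 4.
  move=> uW vW uv u'W v'W u'u u'v v'u v'v.
  have [x xT /andP[ux vx]] := common u v uW vW uv.
  have [y [z l]] := tri_lab TT xT.
  have no w : w \in W -> w != u -> w != v -> ~~ (gadj G w y && gadj G w z).
    move=> wW wu wv; apply/negP => /andP[wy wz].
    have := f3 _ _ _ _ _ _ _ TF l uW vW wW uv; rewrite !(gadjC _ _ w) !(gadjC _ x).
    by move=> /(_ ux vx wy wz); rewrite (negPf wu) (negPf wv).
  have := no u' u'W u'u u'v; have := no v' v'W v'u v'v; rewrite !(dg3 _ _ l).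
  by do 6! case: (gadj _ _ _).
have disj u v : u \in W -> v \in W -> gadj G u v -> exists u' v',
    [/\ u' \in W, v' \in W, gadj G u' v', (u' != u) && (u' != v) & (v' != u) && (v' != v)].
  move=> uW vW uv.
  have : 0 < #|W :\ u :\ v| by have := cardsD1 u W; have := cardsD1 v (W :\ u); slia.
  case/card_gt0P => w; rewrite !in_setD1 => /and3P[wv wu wW].
  have [q] : exists2 q, q \in nb G W w & (q != u) && (q != v).
    case: (boolP (nb G W w \subset [set u; v])) => [s|/subsetPn[q qw]]; last first.
      by rewrite !inE negb_or => h; exists q.
    have E : nb G W w = [set u; v].
      by apply/eqP; rewrite eqEcard s cards2 (gadj_neq uv); apply: W2.
    have : u \in nb G W w by rewrite E !inE eqxx.
    have : v \in nb G W w by rewrite E !inE eqxx orbT.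
    rewrite !inE => /andP[_ wv'] /andP[_ wu'].
    by case: (tfW w u v).
  by rewrite in_set => /andP[qW wq] h; exists w, q; rewrite wu wv.
(* An edge disjoint from [uv] limits [u] and [v] to four edges into [T]; the degree condition then
   makes their disjoint neighbourhoods in [W] fill [W]. *)
have dom u v : u \in W -> v \in W -> gadj G u v -> forall w, w \in W -> gadj G u w || gadj G v w.
  move=> uW vW uv w wW; have [u' [v' [u'W v'W u'v' /andP[u'u u'v] /andP[v'u v'v]]]] := disj u v uW vW uv.
  have h1 : dg G T u + dg G T v <= 4.
    by apply: (le4 u' v') => //; rewrite eq_sym.
  have [h2 _] := edgeT u v uW vW uv.
  have dsj : [disjoint nb G W u & nb G W v].
    rewrite -setI_eq0; apply/eqP/setP => q; rewrite in_setI !in_nb in_set0; apply/negP =>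
      /andP[/andP[qW uq] /andP[_ vq]].
    by apply: (tfW u v q).
  have : #|nb G W u :|: nb G W v| = #|W|.
    apply/eqP; rewrite eqn_leq; apply/andP; split.
      by apply: subset_leq_card; apply/subsetP => q; rewrite in_setU !in_nb => /orP[] /andP[].
    rewrite cardsU (eqP (_ : _ :&: _ == set0)) ?setI_eq0 // cards0 subn0.
    by rewrite -/(dg G W u) -/(dg G W v); slia.
  move=> E; have : nb G W u :|: nb G W v == W.
    rewrite eqEcard E leqnn andbT.
    by apply/subsetP => q; rewrite in_setU !in_nb => /orP[] /andP[].
  by move=> /eqP/setP/(_ w); rewrite wW in_setU !in_nb wW.
(* By [dom], all neighbours of [u] in [W] are joined to all those of [v]. The pair [a], [a'] is
   exchanged, and the third neighbour [a1] forms with [b] and a vertex of [T] the triangle that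
   [rich_apex] forbids. *)
have main u v : u \in W -> v \in W -> gadj G u v -> 2 < dg G W u -> False.
  move=> uW vW uv /card_gt2P[a [a' [a1 [[aP a'P a1P] [aa' a'a1 a1a]]]]].
  have /card_ge2P[b [b' [bR b'R bb']]] := W2 v.
  have full p q : p \in nb G W u -> q \in nb G W v -> gadj G p q.
    rewrite !in_nb => /andP[pW up] /andP[qW vq].
    have /orP[uq|//] := dom u p uW pW up q qW.
    by case: (tfW u v q).
  have inW p s : p \in nb G W s -> p \in W by rewrite in_nb => /andP[].
  have [g [t [_ tF _ _ h]]] := ra _ _ _ _ (inW _ _ aP) (inW _ _ a'P) (inW _ _ bR) (inW _ _ b'R)
    aa' bb' (full _ _ aP bR) (full _ _ a'P bR) (full _ _ aP b'R) (full _ _ a'P b'R).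
  have [x xT /andP[a1x bx]] := common a1 b (inW _ _ a1P) (inW _ _ bR) (full _ _ a1P bR).
  have tE : t = T.
    have /cards1P[t0 Ft] : #|F| == 1 by rewrite F1.
    by move: tF TF; rewrite Ft !inE => /eqP-> /eqP->.
  apply: (h x a1 b); rewrite ?tE //; rewrite ?(inW _ _ a1P) ?(inW _ _ bR) ?(full _ _ a1P bR) //.
  - by rewrite gadjC.
  - by rewrite gadjC.
  - by rewrite eq_sym.
  - by rewrite eq_sym; apply: gadj_neq (full _ _ _ _).
  - by rewrite eq_sym; apply: gadj_neq (full _ _ _ _).
have /card_gt0P[u uW] : 0 < #|W| by slia.
have /ltnW/card_gt0P[v] := W2 u; rewrite in_nb => /andP[vW uv].
have : 2 < dg G W u \/ 2 < dg G W v.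
  have : #|W| <= dg G W u + dg G W v.
    rewrite -cardsUI; apply: leq_trans (leq_addr _ _); apply: subset_leq_card; apply/subsetP => w wW.
    by rewrite in_setU !in_nb wW /=; apply: dom uv w wW.
  slia.
by case; [apply: main uv|apply: main vW uW _; rewrite gadjC].
Qed.
End Two.

Lemma ncol_ge (V C : finType) (c : {set V} -> C) G : rain c G -> #|G| <= ncol c.
Proof.
move=> [G2 Gi]; rewrite -(card_in_imset Gi); apply: subset_leq_card; apply: imsetS.
by apply/subsetP => e /G2 e2; rewrite inE e2.
Qed.

(** * Deleting a vertex *)

Section VertexDeletion.
Variables (V C : finType) (c : {set V} -> C).

Lemma card_star (G : {set {set V}}) v : (forall e, e \in G -> #|e| = 2) ->
  #|[set e in G | v \in e]| = dg G setT v.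
Proof.
move=> G2; rewrite /dg -(card_in_imset (f := fun w => [set v; w])) => [|w w'].
  apply: eq_card => e; rewrite inE; apply/andP/imsetP => [[eG ve]|[w]]; last first.
    by rewrite in_nb => /andP[_ /andP[_ vw]] ->; rewrite vw !inE eqxx.
  have /eqP/cards2P[x [y [xy eE]]] := G2 _ eG; rewrite eE !inE in ve eG *.
  case/orP: ve => /eqP vE; subst v; [exists y|exists x]; rewrite // ?in_nb ?in_setT /gadj ?xy ?eG //.
    by rewrite eq_sym xy setUC eG.
  by rewrite setUC.
rewrite !in_nb => /andP[_ /andP[vw _]] /andP[_ /andP[vw' _]] E.
have : w \in [set v; w'] by rewrite -E !inE eqxx orbT.
by rewrite !inE eq_sym (negPf vw) => /eqP.
Qed.

Lemma delete_vertex (G : {set {set V}}) v k : rain c G -> noP c k ->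
  exists c' : {set {x : V | x != v}} -> C, noP c' k /\ #|G| - dg G setT v <= ncol c'.
Proof.
move=> rG NP; have [G2 Gi] := rG; exists (fun e : {set {x : V | x != v}} => c (val @: e)); split;
  first exact: (noP_img val_inj).
pose G' := [set e : {set {x : V | x != v}} | val @: e \in G].
apply: leq_trans (_ : #|G'| <= _).
  rewrite -(card_star v G2).
  have -> : #|G| - #|[set e in G | v \in e]| = #|[set e in G | v \notin e]|.
    have -> : [set e in G | v \notin e] = G :\: [set e in G | v \in e].
      by apply/setP => e; rewrite !inE; case: (e \in G); case: (v \in e).
    by rewrite cardsD (setIidPr _) //; apply/subsetP => e; rewrite inE => /andP[].
  rewrite -(card_imset G' (imset_inj val_inj)); apply: subset_leq_card; apply/subsetP => e.
  rewrite inE => /andP[eG ve].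
  have eE : e = val @: [set x : {x : V | x != v} | val x \in e].
    apply/setP => x; apply/idP/imsetP => [xe|[y]]; last by rewrite inE => ? ->.
    have xv : x != v by apply: contraNneq ve => <-.
    by exists (exist _ x xv); rewrite ?inE.
  by apply/imsetP; exists [set x : {x : V | x != v} | val x \in e]; rewrite // inE -eE.
apply: ncol_ge; split => [e|e f]; rewrite !inE; first by move=> /G2; rewrite card_imset //; apply:
  val_inj.
by move=> eG fG E; apply: (imset_inj val_inj); apply: Gi.
Qed.
End VertexDeletion.

Lemma two_triangles n (V C : finType) (c : {set V} -> C) : 7 <= n -> #|V| = n -> noP c 2 ->
  ncol c < n ^ 2 %/ 4 + 2.
Proof.
elim: n V C c => [//|n IH] V C c n7 Vn NP; rewrite ltnNge; apply/negP => le.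
have [G rG cG] := rain_ex le.
have [n6|n6] := leqP 7 n; last first.
  have E : n = 6 by lia.
  by apply: (no_rainbow_on_seven NP _ rG); rewrite ?Vn ?cG E.
have [/existsP[v]|] := boolP [exists v, dg G setT v <= n.+1 %/ 2]; last first.
  rewrite negb_exists => /forallP h; apply: (min_degree_two NP _ rG); rewrite ?Vn ?cG //.
    by move=> v; rewrite ltnNge.
  by lia.
move=> dv; have [c' [NP' le']] := delete_vertex v rG NP.
have := IH _ _ c' n6 _ NP'.
have -> : #|{: {x : V | x != v}}| = n.
  by rewrite card_sig; have := cardC1 v; rewrite Vn /= => <-; apply: eq_card => x; rewrite !inE.
move=> /(_ erefl); rewrite cG in le'.
(* The bound drops by at least [n.+1 %/ 2] from [n.+1] to [n] vertices, which covers the edges lost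
   with [v]. *)
have : n ^ 2 %/ 4 + n.+1 %/ 2 <= n.+1 ^ 2 %/ 4.
  by rewrite !expnS !expn0 !muln1; have := divn_eq n 2; have := ltn_mod n 2; nia.
by lia.
Qed.

(** * Edge counts *)

Section Counting.
Variables (V : finType) (G : {set {set V}}).
Implicit Types (A B E W I t : {set V}) (x y z u v w a : V).

Lemma gadjxx x : gadj G x x = false.
Proof. by rewrite /gadj eqxx. Qed.

Lemma eo_add A z : z \notin A -> eo G (z |: A) (z |: A) = eo G A A + 2 * dg G A z.
Proof.
move=> zA; have d : [disjoint [set z] & A] by rewrite disjoints1.
have e1 B : eo G [set z] B = dg G B z by rewrite /eo big_set1.
rewrite eoUl // !eoUr // (eoC G A [set z]) !e1.
have -> : dg G [set z] z = 0 by rewrite dgE big_set1 gadjxx.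
lia.
Qed.

Lemma dgD1 A w : dg G (A :\ w) w = dg G A w.
Proof.
apply: eq_card => x; rewrite !in_nb !inE.
by case: eqP => [->|//]; rewrite gadjxx !andbF.
Qed.

Lemma dg_D1 A w z : dg G A z <= (dg G (A :\ w) z).+1.
Proof.
rewrite [dg G A z]/dg (cardsD1 w); have : #|nb G A z :\ w| <= dg G (A :\ w) z.
  by apply: subset_leq_card; apply/subsetP => x; rewrite in_setD1 !in_nb !inE => /and3P[-> -> ->].
by case: (w \in _) => /=; lia.
Qed.

Lemma max_indep W : exists I, [/\ I \subset W, indep G I &
  forall J : {set V}, J \subset W -> indep G J -> #|J| <= #|I|].
Proof.
have h0 : (fun I : {set V} => (I \subset W) && indep G I) set0.
  by rewrite sub0set; apply/indepP => x; rewrite inE.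
case: (@arg_maxnP _ set0 (fun I : {set V} => (I \subset W) && indep G I) (fun I => #|I|) h0) =>
  I /andP[IW iI] mI.
by exists I; split=> // J JW iJ; apply: mI; rewrite JW.
Qed.

Lemma indepS A B : A \subset B -> indep G B -> indep G A.
Proof. by move=> /subsetP s /indepP h; apply/indepP => x y /s xB /s yB; apply: h. Qed.

Lemma nb_sub W x : nb G W x \subset W.
Proof. by apply/subsetP => w; rewrite in_nb => /andP[]. Qed.

(** In a triangle-free set the neighbourhoods are independent, so a maximum independent set bounds
    every degree. *)
Lemma eo_indepW W I : trifree G W -> I \subset W -> indep G I ->
  (forall J : {set V}, J \subset W -> indep G J -> #|J| <= #|I|) ->
    eo G W W <= 2 * (#|I| * (#|W| - #|I|)).
Proof.
move=> tf IW iI mI; apply: eo_indep => // v vW.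
by apply: mI; [apply: nb_sub|apply: nb_indep].
Qed.

Lemma eo_self_leq A : eo G A A <= #|A| * #|A|.-1.
Proof.
rewrite -sum_nat_const; apply: leq_sum => x xA.
rewrite -(dgD1 A) (cardsD1 x A) xA /=; exact: dg_leq.
Qed.

(* The vertices of R = W - E pairwise have at most one common neighbour in W, and none when
   adjacent. Double counting cherries bounds the sum of d^2, where d is the degree into R; it is
   estimated below by the tangents 7d - 12 on E and 3d - 2 on R. *)
Lemma cherry_count W E : trifree G W -> E \subset W ->
  (forall a a', a \in W :\: E -> a' \in W :\: E -> a != a' -> #|nb G W a :&: nb G W a'| <= 1) ->
  let r := #|W :\: E| in
  6 * eo G W W <= 3 * #|E| ^ 2 + 2 * (r * r.+1) + 24 * #|E|.
Proof.
move=> tf EW; set R := W :\: E => h /=; set r := #|R|.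
have dER : [disjoint E & R] by rewrite -setI_eq0; apply/eqP/setP => x; rewrite !inE; case: (x \in E).
have defW : W = E :|: R by rewrite /R -{1}(setID W E) (setIidPr EW).
have mE : 2 * eo G E E <= #|E| ^ 2.
  by apply: mantel => x y z /(subsetP EW) xW /(subsetP EW) yW /(subsetP EW) zW; apply: tf.
pose d v := dg G R v.
have sq : \sum_(v in W) d v ^ 2 <= eo G R E + r * r.-1.
  have -> : \sum_(v in W) d v ^ 2 = \sum_(a in R) \sum_(a' in R) #|nb G W a :&: nb G W a'|.
    rewrite (eq_bigr (fun v => \sum_(a in R) \sum_(a' in R) (gadj G v a * gadj G v a'))) => [|v _].
      rewrite exchange_big /=; apply: eq_bigr => a _; rewrite exchange_big /=; apply: eq_bigr => a' _.
      rewrite -sum1_card [RHS](eq_bigl (fun v => (v \in W) && (gadj G v a && gadj G v a'))); last first.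
        by move=> v; rewrite in_setI !in_nb !(gadjC _ v); case: (v \in W).
      rewrite big_mkcondr /=; apply: eq_bigr => v _; by do 2! case: (gadj _ _ _).
    rewrite expnS expn1 /d dgE big_distrl /=; apply: eq_bigr => a _.
    by rewrite big_distrr.
  have : \sum_(a in R) \sum_(a' in R) #|nb G W a :&: nb G W a'| + eo G R R <= eo G R W + r * r.-1.
    rewrite -sum_nat_const /eo -!big_split /=; apply: leq_sum => a aR.
    rewrite (big_setD1 a) //= setIid -/(dg G W a) -addnA leq_add2l.
    have -> : r.-1 = #|R :\ a| by rewrite /r (cardsD1 a R) aR.
    rewrite -(dgD1 R) dgE -big_split /= -sum1_card; apply: leq_sum => a'; rewrite in_setD1 =>
      /andP[a'a a'R].
    have := h a a' aR a'R; rewrite eq_sym a'a => /(_ isT).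
    case E1: (gadj G a a') => //=; rewrite ?addn0 // => _.
    rewrite (eqP (_ : _ :&: _ == set0)) ?cards0 //.
    apply/eqP/setP => w; rewrite in_setI !in_nb in_set0; apply/negP => /andP[/andP[wW aw] /andP[_ a'w]].
    have [aW a'W] : a \in W /\ a' \in W by move: aR a'R; rewrite !inE => /andP[_ ->] /andP[_ ->].
    by apply: (tf a a' w).
  have -> : eo G R W = eo G R E + eo G R R by rewrite -eoUr // -defW.
  move: (\sum_(a in R) _) => S; lia.
have lowE : 7 * eo G E R <= \sum_(v in E) d v ^ 2 + 12 * #|E|.
  rewrite [12 * _]mulnC -sum_nat_const /eo big_distrr -big_split /=; apply: leq_sum => v _.
  by rewrite -/(d v) expnS expn1; case: (d v) => [|[|[|[|m]]]] //; nia.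
have lowR : 3 * eo G R R <= \sum_(v in R) d v ^ 2 + 2 * r.
  rewrite [2 * _]mulnC -sum_nat_const /eo big_distrr -big_split /=; apply: leq_sum => v _.
  by rewrite -/(d v) expnS expn1; case: (d v) => [|[|m]] //; nia.
have sumW : \sum_(v in W) d v ^ 2 = \sum_(v in E) d v ^ 2 + \sum_(v in R) d v ^ 2.
  have : \sum_(v in E :|: R) d v ^ 2 = \sum_(v in E) d v ^ 2 + \sum_(v in R) d v ^ 2.
    by rewrite -bigU //=; apply: eq_bigl => x; rewrite !inE.
  by rewrite -defW.
have eW : eo G W W = eo G E E + 2 * eo G E R + eo G R R.
  have : eo G (E :|: R) (E :|: R) = eo G E E + 2 * eo G E R + eo G R R.
    by rewrite eoUl // !eoUr // (eoC G R E); lia.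
  by rewrite -defW.
have rr : r * r.+1 = r * r.-1 + 2 * r by case: (r) => // m; rewrite /=; nia.
have eRE : eo G R E = eo G E R by rewrite eoC.
move: sq lowE lowR; rewrite sumW eRE eW rr; clear -mE; move: (\sum_(v in E) _) (\sum_(v in R) _); lia.
Qed.

End Counting.

Lemma bin2_double n : 2 * 'C(n, 2) = n * n.-1.
Proof. by have := bin_ffact n 2; rewrite !ffactnS ffactn0 muln1 -[2`!]/2 mulnC. Qed.

(** * Arithmetic of the edge counts: [q] is the number of triangles in [F], [N] the size of [W],
    [al] that of [I], [eW] twice the number of edges inside [W], and [S] the number of edges from
    [W] to the cover of [F] *)

Lemma num_total (q N g eW S : nat) : 2 <= q -> 2 * q ^ 2 + 3 <= N ->
  g = (N + 2 * q + 1) ^ 2 %/ 4 + (q - 1) * (N + 2 * q + 1) + 'C(q - 1, 2) + 2 ->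
  2 * g <= eW + 2 * S + 3 * q * (3 * q).-1 ->
  N ^ 2 + (8 * q - 4) * N + 14 <= 2 * eW + 4 * S.
Proof.
move=> q2 hN gE le; have := bin2_double (q - 1).
have [p qE] : exists p, q = p + 2 by exists (q - 2); lia.
have [d] : exists d, (N + 2 * q + 1) ^ 2 <= 4 * d + 3 /\ d = (N + 2 * q + 1) ^ 2 %/ 4 by eexists;
  split; last by []; lia.
case=> h dE; rewrite -dE in gE; move: gE le h hN.
have -> : q - 1 = p.+1 by lia.
move: 'C(_, 2) => b /=; rewrite !expnS !expn0 !muln1 {dE}; subst q; move=> -> le h hN hb.
have E3 : (3 * (p + 2)).-1 = 3 * p + 5 by lia.
rewrite E3 in le.
have -> : 8 * (p + 2) - 4 = 8 * p + 12 by lia.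
nia.
Qed.

Lemma num_al (q N al eW S : nat) : 2 <= q -> 2 * q ^ 2 + 3 <= N -> al <= N ->
  N ^ 2 + (8 * q - 4) * N + 14 <= 2 * eW + 4 * S -> eW <= 2 * (al * (N - al)) ->
  S <= q * (2 * N + 2) -> al + 2 <= N.
Proof.
move=> q2 hN al_leN le eWle Sle; rewrite leqNgt; apply/negP => al1.
have : al * (N - al) <= N.
  have [->|->] : al = N \/ al = N - 1 by lia.
    by rewrite subnn muln0.
  have -> : N - (N - 1) = 1 by lia.
  by rewrite muln1; lia.
have [p qE] : exists p, q = p + 2 by exists (q - 2); lia.
have E1 : 8 * q - 4 = 8 * p + 12 by lia.
rewrite E1 in le; rewrite !expnS !expn0 !muln1 in hN le; subst q; nia.
Qed.

Lemma num_flats (q N al eW S : nat) : 2 <= q ->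
  N ^ 2 + (8 * q - 4) * N + 14 <= 2 * eW + 4 * S -> eW <= 2 * (al * (N - al)) -> al <= N ->
  S <= 2 * (N + al + 1) + (q - 2) * (2 * N) -> False.
Proof.
move=> q2 le eWle al_leN Sle; have [p qE] : exists p, q = p + 2 by exists (q - 2); lia.
have [be NE] : exists be, N = al + be by exists (N - al); lia.
have E1 : 8 * q - 4 = 8 * p + 12 by lia.
have E2 : q - 2 = p by lia.
have E3 : N - al = be by lia.
rewrite E1 in le; rewrite E2 in Sle; rewrite E3 in eWle; rewrite expnS expn1 in le; subst N q.
have : 2 * ((al - be) * (al - be)) + 2 * ((be - al) * (be - al)) >= 0 by [].
have [h|h] := leqP be al.
  (* The bounds combine to [(m - 2)^2 + 2 <= 0]. *)
  have [m mE] : exists m, al = be + m by exists (al - be); lia.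
  by subst al; have : (m - 2) * (m - 2) >= 0 by []; case: m {h E3 al_leN} le eWle Sle => [|[|m]]; nia.
have [m mE] : exists m, be = al + m by exists (be - al); lia.
by subst be; nia.
Qed.

Lemma num_rich (q N e r eW : nat) : 2 <= q -> 2 * q ^ 2 + 3 <= N -> e <= 2 * q -> e + r = N ->
  N ^ 2 + 14 <= 2 * eW + 4 * N -> 6 * eW <= 3 * e ^ 2 + 2 * (r * r.+1) + 24 * e -> False.
Proof.
move=> q2 hN eq NE le1 le2; rewrite !expnS !expn0 !muln1 in hN le1 le2.
have h1 : 5 * e + 22 <= 4 * N by nia.
have h2 : 14 * N <= N * N + 41 by nia.
have h3 : e * (5 * e + 22) <= e * (4 * N) by rewrite leq_mul2l h1 orbT.
subst N; nia.
Qed.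

Lemma num_al2 (q N al eW : nat) : 3 <= q -> 2 * q ^ 2 + 3 <= N -> al <= N ->
  N ^ 2 + 14 <= 2 * eW + 4 * N -> eW <= 2 * (al * (N - al)) -> al + 2 * q <= N.
Proof.
move=> q3 hN al_leN le eWle; rewrite leqNgt; apply/negP => al1.
have [be NE] : exists be, N = al + be by exists (N - al); lia.
have E3 : N - al = be by lia.
rewrite E3 in eWle; rewrite !expnS !expn0 !muln1 in hN le.
have h1 : be <= 2 * q - 1 by lia.
have h2 : al >= 2 * q * q + 4 - 2 * q by lia.
have [m mE] : exists m, al = be + m by exists (al - be); nia.
have h3 : m * m + 14 <= 4 * N by subst N al; nia.
have h4 : m + 4 * q >= N + 2 by lia.
have h5 : 4 * q <= N by nia.
have h6 : (N + 2 - 4 * q) * (N + 2 - 4 * q) + 14 <= 4 * N.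
  apply: leq_trans h3; rewrite leq_add2r; apply: leq_mul; lia.
have [j jE] : exists j, N = 4 * q + j by exists (N - 4 * q); lia.
have E4 : N + 2 - 4 * q = j + 2 by lia.
rewrite E4 in h6; subst N; clear -h6 hN jE q3.
have h7 : 2 * q + 3 <= j by nia.
have h8 := leq_mul h7 h7; nia.
Qed.

(** The estimates are tight up to a constant: all terms in [N] and [q] cancel, and [4 <= 2]
    remains. *)
Lemma num_final (q N g X : nat) : 2 <= q ->
  g = (N + 2 * q + 1) ^ 2 %/ 4 + (q - 1) * (N + 2 * q + 1) + 'C(q - 1, 2) + 2 ->
  2 * g <= X + (q - 1) * (4 * N + 18 + 7 * (q - 2)) -> X <= 2 * ((N + 3) ^ 2 %/ 4) + 2 -> False.
Proof.
move=> q2 gE le XE; have := bin2_double (q - 1).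
have [p qE] : exists p, q = p + 2 by exists (q - 2); lia.
have E0 : (N + 2 * q + 1) ^ 2 %/ 4 = (N + 3) ^ 2 %/ 4 + (p + 1) * (N + 3) + (p + 1) * (p + 1).
  have -> : N + 2 * q + 1 = (N + 3) + 2 * (p + 1) by lia.
  have -> : (N + 3 + 2 * (p + 1)) ^ 2 = (N + 3) ^ 2 + ((p + 1) * (N + 3) + (p + 1) * (p + 1)) * 4.
    by rewrite !expnS !expn0 !muln1; nia.
  by rewrite divnDMl //; lia.
rewrite E0 in gE; have E1 : q - 1 = p.+1 by lia.
have E2 : q - 2 = p by lia.
rewrite E1 in gE le *; rewrite E2 in le; move: 'C(_, 2) gE => b gE hb.
move: (_ %/ 4) XE gE {E0} => f XE gE; subst q; simpl in *; nia.
Qed.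

Lemma sqrn_mod4 n : exists m, n ^ 2 = 4 * m \/ n ^ 2 = 4 * m + 1.
Proof.
rewrite -(odd_double_half n) -mul2n expnS expn1; move: n./2 => h.
by exists (h * h + odd n * h); case: (odd n) => /=; [right|left]; nia.
Qed.

(** * A packing whose complement spans the most edges *)

Section Maximal.
Variables (V C : finType) (c : {set V} -> C) (k : nat) (G F : {set {set V}}) (W I : {set V}).
Hypotheses (NP : noP c k) (rG : rain c G) (pF : packing G F) (Fk : #|F|.+1 = k).
Hypothesis WE : W = ~: cover F.
Hypothesis maxF : forall F', packing G F' -> #|F'| = #|F| ->
  eo G (~: cover F') (~: cover F') <= eo G W W.
Hypotheses (IW : I \subset W) (iI : indep G I)
  (maxI : forall J : {set V}, J \subset W -> indep G J -> #|J| <= #|I|).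
Implicit Types (t : {set V}) (x y z u v w : V).
Let N := #|W|.
Let al := #|I|.

Let tfW : trifree G W. Proof. by rewrite WE; apply: (W_trifree NP). Qed.

Lemma al_leN : al <= N. Proof. exact: subset_leq_card. Qed.

Lemma WF t x w : t \in F -> x \in t -> w \in W -> w != x.
Proof. by move=> tF xt; rewrite WE in_setC; apply: contraNneq => ->; apply: in_cover xt. Qed.

(* Replacing xyz by xyw in F trades w for z in W; by maximality this gains no edge. *)
Lemma swap_bound t x y z w : t \in F -> lab t x y z -> w \in W -> gadj G x w -> gadj G y w ->
  dg G W z <= (dg G W w).+1.
Proof.
move=> tF l wW xw yw; have tt := packing_tri pF tF.
have [xy xz yz] := lab_adj tt l; have [xt yt zt] := lab_in l.
have [|pF0 cF0 vF0] := @trans_packing V G G F t pF tF.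
  by move=> s sF _; apply: packing_tri pF sF.
have [||F1 [pF1 cF1 vF1]] := @packing_push V G (F :\ t) [set x; y; w] pF0.
- exact: tri3.
- by rewrite vF0 disjoint3 !inE xt yt /=; move: (wW); rewrite WE in_setC => /negPf->; rewrite andbF.
have := maxF pF1; rewrite cF1 cF0 => /(_ erefl).
have -> : ~: cover F1 = z |: (W :\ w).
  apply/setP => p; rewrite vF1 vF0 WE !inE !negb_or negb_and negbK.
  have [->|pz] := eqVneq p z.
    rewrite eq_sym (gadj_neq xz) eq_sym (gadj_neq yz) zt /= andbT.
    by rewrite eq_sym; apply: WF zt wW.
  have [pt|pt] := boolP (p \in t); last first.
    have px : p != x by apply: contraNneq pt => ->.
    have py : p != y by apply: contraNneq pt => ->.
    by rewrite px py /=.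
  rewrite (in_cover tF pt) andbF; case: l pt => -> _ _ _; rewrite !inE (negPf pz) orbF => /orP[] /eqP->;
    by rewrite eqxx ?andbF.
rewrite eo_add; last by rewrite !inE WE inE (in_cover tF zt) andbF.
have : eo G W W = eo G (W :\ w) (W :\ w) + 2 * dg G (W :\ w) w.
  by rewrite -eo_add ?setD1K // !inE eqxx.
rewrite dgD1; have := dg_D1 G W w z; slia.
Qed.

Definition flat t := [forall x in t, indep G (nb G W x)].

Lemma apexP t : t \in F -> ~~ flat t -> exists x u v,
  [/\ x \in t, u \in W & v \in W] /\ [/\ gadj G x u, gadj G x v & gadj G u v].
Proof.
move=> tF /forall_inPn[x xt] /forall_inPn[u]; rewrite in_nb => /andP[uW xu] /forall_inPn[v].
by rewrite in_nb => /andP[vW xv]; rewrite negbK => uv; exists x, u, v.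
Qed.

Lemma nbU_le x y : #|nb G W x :|: nb G W y| <= N.
Proof. by apply: subset_leq_card; rewrite subUset !nb_sub. Qed.

(** By the swap, [z] has at most one more neighbour in [W] than [w]. By flatness no neighbour of [w]
    in [W] is adjacent to [x] or [y], and the common neighbours of [x] and [y] in [W] are
    independent. *)
Lemma flat_pair t x y z w : t \in F -> flat t -> lab t x y z -> w \in W -> gadj G x w -> gadj G y w ->
  eo G t W <= N + al + 1.
Proof.
move=> tF /forall_inP ft l wW xw yw; rewrite (dg_lab _ _ l).
have [xt yt zt] := lab_in l; have [/indepP ix /indepP iy] := (ft x xt, ft y yt).
have h1 := swap_bound tF l wW xw yw.
have h2 : dg G W w + #|nb G W x :|: nb G W y| <= N.
  rewrite -cardsUI [X in _ + X]eq_card0 ?addn0; last first.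
    move=> p; rewrite in_setI in_setU !in_nb; apply/negP => /andP[/andP[pW wp]].
    rewrite pW /= => /orP[xp|yp]; [move: (ix w p)|move: (iy w p)];
      rewrite !in_nb wW pW ?xw ?yw ?xp ?yp wp.
      by move=> /(_ isT isT).
    by move=> /(_ isT isT).
  by apply: subset_leq_card; rewrite !subUset !nb_sub.
have h3 : #|nb G W x :&: nb G W y| <= al.
  apply: maxI; first by rewrite subIset ?nb_sub.
  by apply: indepS (subsetIl _ _) (ft x xt).
have := cardsUI (nb G W x) (nb G W y); rewrite -/(dg G W x) -/(dg G W y); slia.
Qed.

(** Either two vertices of [t] share a neighbour in [W], or the three neighbourhoods are disjoint
    and have at most [N] elements altogether. *)
Lemma flat_bound t : t \in F -> flat t -> eo G t W <= N + al + 1.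
Proof.
move=> tF ft; have [x [y [z l]]] := tri_ex (packing_tri pF tF).
have pairs p q r : lab t p q r -> eo G t W <= N + al + 1 \/ dg G W p + dg G W q <= #|nb G W p :|:
  nb G W q|
    /\ [disjoint nb G W p & nb G W q].
  move=> lp; have [d|/pred0Pn[w /andP[]]] := boolP [disjoint nb G W p & nb G W q].
    right; split=> //; move: d; rewrite -setI_eq0 => /eqP d.
    by rewrite /dg -cardsUI d cards0 addn0.
  by rewrite /= !in_nb => /andP[wW pw] /andP[_ qw]; left; apply: flat_pair lp wW pw qw.
case: (pairs x y z l) => [//|[h1 d1]]; case: (pairs x z y (labC l)) => [//|[h2 d2]].
case: (pairs y z x (labR l)) => [//|[h3 d3]].
rewrite (dg_lab _ _ l).
have : #|(nb G W x :|: nb G W y) :|: nb G W z| <= N by apply: subset_leq_card; rewrite !subUset !nb_sub.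
have d : [disjoint nb G W x :|: nb G W y & nb G W z].
  by rewrite disjoints_subset subUset -!disjoints_subset d2.
move: d; rewrite -setI_eq0 => /eqP d; have := cardsUI (nb G W x :|: nb G W y) (nb G W z).
by rewrite d cards0 -/(dg G W z); slia.
Qed.

Lemma apex_common t x y z u v : t \in F -> lab t x y z -> u \in W -> v \in W ->
  gadj G u v -> gadj G x u -> gadj G x v -> nb G W y :&: nb G W z \subset [set u; v].
Proof.
move=> tF l uW vW uv xu xv; apply/subsetP => w; rewrite in_setI !in_nb =>
  /andP[/andP[wW yw] /andP[_ zw]].
have := apex_unique_common NP rG pF Fk tF l; rewrite -WE => /(_ _ _ _ uW vW wW uv xu xv yw zw).
by rewrite !inE.
Qed.

Lemma apex_sum t x y z u v : t \in F -> lab t x y z -> u \in W -> v \in W ->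
  gadj G u v -> gadj G x u -> gadj G x v -> dg G W y + dg G W z <= N + 2.
Proof.
move=> tF l uW vW uv xu xv; have := subset_leq_card (apex_common tF l uW vW uv xu xv).
rewrite cards2 (gadj_neq uv) -[dg G W y]/#|_| -[dg G W z]/#|_| -cardsUI.
have := nbU_le y z; slia.
Qed.

(** Only [u] and [v] can be common neighbours of [y] and [z] in [W]. If neither is, the bound is
    [2 * N]. If one is, the swap leaves [x] at most [al + 1] neighbours. If both are, it leaves at
    most [N / 2 + 1], because [u] and [v] are adjacent, and [6 <= N] absorbs the rest. *)
Lemma apex_bound t x y z u v : 6 <= N -> t \in F -> lab t x y z -> u \in W -> v \in W ->
  gadj G u v -> gadj G x u -> gadj G x v -> eo G t W <= maxn (2 * N) (N + al + 2).
Proof.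
move=> N6 tF l uW vW uv xu xv; rewrite (dg_lab _ _ l).
have s := apex_common tF l uW vW uv xu xv.
have sU := nbU_le y z; have cU := cardsUI (nb G W y) (nb G W z).
rewrite -/(dg G W y) -/(dg G W z) in cU.
have dx : dg G W x <= N by apply: dg_leq.
have sw w : w \in nb G W y :&: nb G W z -> dg G W x <= (dg G W w).+1 /\ dg G W w <= al.
  rewrite in_setI !in_nb => /andP[/andP[wW yw] /andP[_ zw]]; split.
    exact: swap_bound tF (labR l) wW yw zw.
  by apply: maxI; rewrite ?nb_sub // nb_indep.
have [uI|uI] := boolP (u \in nb G W y :&: nb G W z); have [vI|vI] := boolP (v \in nb G W y :&: nb G W z).
- have [hu _] := sw u uI; have [hv _] := sw v vI; have := dg_trifree tfW uW vW uv.
  have := subset_leq_card s; rewrite cards2 (gadj_neq uv) -/N; slia.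
- have [h1 h2] := sw u uI; have : #|nb G W y :&: nb G W z| <= #|[set u]|.
    apply: subset_leq_card; apply/subsetP => w wI; have := subsetP s w wI; rewrite !inE =>
      /orP[//|/eqP wv].
    by rewrite -wv wI in vI.
  rewrite cards1; slia.
- have [h1 h2] := sw v vI; have : #|nb G W y :&: nb G W z| <= #|[set v]|.
    apply: subset_leq_card; apply/subsetP => w wI; have := subsetP s w wI; rewrite !inE =>
      /orP[/eqP wu|//].
    by rewrite -wu wI in uI.
  rewrite cards1; slia.
have : #|nb G W y :&: nb G W z| = 0.
  apply: eq_card0 => w; apply/negP => wI; have := subsetP s w wI; rewrite !inE => /orP[]/eqP E; subst w.
    by rewrite wI in uI.
  by rewrite wI in vI.
slia.
Qed.

(** Here [x] has at most [al + 2] neighbours in [W], and [apex_sum] bounds the other two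
    vertices. *)
Lemma apex_small t x y z u v (D : {set V}) : t \in F -> lab t x y z -> u \in W -> v \in W ->
  gadj G u v -> gadj G x u -> gadj G x v -> #|D| <= 2 -> indep G (nb G W x :\: D) ->
  eo G t W <= N + al + 4.
Proof.
move=> tF l uW vW uv xu xv D2 iD; rewrite (dg_lab _ _ l).
have h := apex_sum tF l uW vW uv xu xv.
have h1 : #|nb G W x :\: D| <= al by apply: maxI => //; rewrite subDset subsetU ?nb_sub ?orbT.
have := cardsD (nb G W x) D; have : #|nb G W x :&: D| <= #|D| by rewrite subset_leq_card ?subsetIr.
rewrite -/(dg G W x); slia.
Qed.

Lemma eoWW : eo G W W <= 2 * (al * (N - al)).
Proof. exact: eo_indepW. Qed.

Lemma eo_cover A : eo G (cover F) A = \sum_(t in F) eo G t A.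
Proof. by rewrite /eo big_trivIset //; case/andP: pF. Qed.

(** The edges inside the cover of [F] are bounded as if it were complete. *)
Lemma total_edges : 2 * #|G| <= eo G W W + 2 * \sum_(t in F) eo G t W + 3 * #|F| * (3 * #|F|).-1.
Proof.
have [G2 _] := rG; rewrite eo_card // -eo_cover -(packing_cover pF).
have := eo_self_leq G (cover F).
have -> : eo G setT setT = eo G W W + 2 * eo G (cover F) W + eo G (cover F) (cover F).
  rewrite -(setUCr (cover F)) -WE.
  have d : [disjoint cover F & W] by rewrite WE disjointC.
  by rewrite eoUl // !eoUr // (eoC G W (cover F)); slia.
slia.
Qed.

Let q := #|F|.
Hypotheses (q2 : 2 <= q) (hN : 2 * q ^ 2 + 3 <= N).
Hypothesis GE :
  #|G| = (N + 2 * q + 1) ^ 2 %/ 4 + (q - 1) * (N + 2 * q + 1) + 'C(q - 1, 2) + 2.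

Lemma N_ge11 : 11 <= N.
Proof. by move: hN q2; clear; rewrite expnS expn1; nia. Qed.

Lemma sum_lower : N ^ 2 + (8 * q - 4) * N + 14 <= 2 * eo G W W + 4 * \sum_(t in F) eo G t W.
Proof. exact: num_total q2 hN GE total_edges. Qed.

Lemma apex_le t : t \in F -> ~~ flat t -> eo G t W <= maxn (2 * N) (N + al + 2).
Proof.
move=> tF nf; have [x [u [v [[xt uW vW] [xu xv uv]]]]] := apexP tF nf.
have [y [z l]] := tri_lab (packing_tri pF tF) xt.
by apply: apex_bound tF l uW vW uv xu xv; apply: leq_trans N_ge11.
Qed.

Lemma sumF_le (m : nat) (A : {set {set V}}) : (forall t, t \in A -> eo G t W <= m) ->
  \sum_(t in A) eo G t W <= #|A| * m.
Proof. by move=> h; rewrite -sum_nat_const; apply: leq_sum. Qed.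

(** A larger independent set would leave too few edges inside [W]. The inequality brings the bounds
    for flat and for other triangles down to [2 * N]. *)
Lemma al2N : al + 2 <= N.
Proof.
apply: (num_al q2 hN al_leN sum_lower eoWW); apply: sumF_le => t tF.
have := al_leN; have [ft|ft] := boolP (flat t); first by have := flat_bound tF ft; slia.
by have := apex_le tF ft; slia.
Qed.

Lemma eo2N t : t \in F -> eo G t W <= 2 * N.
Proof.
move=> tF; have := al2N; have [ft|ft] := boolP (flat t); first by have := flat_bound tF ft; slia.
by have := apex_le tF ft; slia.
Qed.

(** A flat triangle sends only [N + al + 1] edges to [W]; two of them lose more than [sum_lower]
    allows. *)
Lemma one_flat t t' : t \in F -> t' \in F -> flat t -> flat t' -> t = t'.
Proof.
move=> tF t'F ft ft'; apply/eqP/negPn/negP => tt'.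
apply: (num_flats q2 sum_lower eoWW al_leN).
rewrite (big_setD1 t) //= (big_setD1 t') /=; last by rewrite !inE eq_sym tt'.
have -> : q - 2 = #|F :\ t :\ t'|.
  have e1 := cardsD1 t F; have e2 := cardsD1 t' (F :\ t).
  by rewrite tF in e1; rewrite in_setD1 eq_sym tt' t'F in e2; rewrite /q; move: e1 e2 => -> ->;
    rewrite /= !add1n subn2.
have : \sum_(s in F :\ t :\ t') eo G s W <= #|F :\ t :\ t'| * (2 * N).
  by apply: sumF_le => s; rewrite !inE => /and3P[_ _]; apply: eo2N.
have := flat_bound tF ft; have := flat_bound t'F ft'; move:
  (eo G t W) (eo G t' W) (\sum_(s in _) _) (_ * (2 * N)) => ? ? ? ?; clear; lia.
Qed.

Lemma eoW_lower : N ^ 2 + 14 <= 2 * eo G W W + 4 * N.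
Proof.
have := sum_lower; have : \sum_(t in F) eo G t W <= q * (2 * N) by exact: sumF_le eo2N.
move: (eo G W W) (\sum_(t in F) _) => e S; rewrite expnS expn1; move: q2; clear; nia.
Qed.

(** Without such a pair [cherry_count] applies, and its bound on the edges inside [W] contradicts
    [eoW_lower]. *)
Lemma rich_pair (E : {set V}) : E \subset W -> #|E| <= 2 * q -> exists a a' b b',
  [/\ a \in W, a' \in W, a \notin E, a' \notin E & a != a'] /\
  [/\ b \in W, b' \in W & b != b'] /\
  [/\ gadj G a b, gadj G a' b, gadj G a b' & gadj G a' b'].
Proof.
move=> EW Eq.
case: (boolP [exists a in W :\: E, exists a' in W :\: E, (a != a') && (1 < #|nb G W a :&: nb G W a'|)]).
  case/exists_inP => a; rewrite inE => /andP[aE aW] /exists_inP[a']; rewrite inE =>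
    /andP[a'E a'W] /andP[aa'].
  case/card_ge2P => b [b' [bI b'I bb']]; exists a, a', b, b'; move: bI b'I; rewrite !in_setI !in_nb.
  by move=> /andP[/andP[bW ab] /andP[_ a'b]] /andP[/andP[b'W ab'] /andP[_ a'b']].
move=> no; exfalso; apply: (num_rich q2 hN Eq (r := #|W :\: E|) _ eoW_lower).
  by rewrite /N -(cardsID E W) (setIidPr EW).
apply: cherry_count tfW EW _ => a a' aR a'R aa'; rewrite leqNgt; apply: contra no => h.
by apply/exists_inP; exists a => //; apply/exists_inP; exists a' => //; rewrite aa'.
Qed.

Definition is_apex t (p : V * V * V) := [&& p.1.1 \in t, p.1.2 \in W, p.2 \in W,
  gadj G p.1.1 p.1.2, gadj G p.1.1 p.2 & gadj G p.1.2 p.2].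

Lemma choose_apex (A : {set {set V}}) : A \subset F -> (forall t, t \in A -> ~~ flat t) ->
  exists ap : {set V} -> V * V * V, forall t, t \in A -> is_apex t (ap t).
Proof.
move=> AF nf; have /card_gt0P[w0 _] : 0 < #|W| by apply: leq_trans N_ge11.
exists (fun t => odflt (w0, w0, w0) [pick p | is_apex t p]) => t tA.
case: pickP => [p //|no] /=.
have [x [u [v [[xt uW vW] [xu xv uv]]]]] := apexP (subsetP AF _ tA) (nf t tA).
by have := no (x, u, v); rewrite /is_apex /= xt uW vW xu xv uv.
Qed.

(** The vertices that a rich pair has to avoid for all the chosen triangles to remain available. *)
Definition feet (A : {set {set V}}) (ap : {set V} -> V * V * V) : {set V} :=
  [set (ap t).1.2 | t in A] :|: [set (ap t).2 | t in A].

Lemma feet_card (A : {set {set V}}) ap : #|feet A ap| <= 2 * #|A|.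
Proof.
apply: leq_trans (leq_card_setU _ _) _; rewrite mul2n -addnn.
by apply: leq_add; apply: leq_imset_card.
Qed.

Lemma feet_sub (A : {set {set V}}) ap : (forall t, t \in A -> is_apex t (ap t)) -> feet A ap \subset W.
Proof.
by move=> h; apply/subsetP => x; rewrite inE => /orP[] /imsetP[t /h/and5P[_ uW vW _ _] ->].
Qed.

Lemma feet_in (A : {set {set V}}) (ap : {set V} -> V * V * V) t : t \in A ->
  ((ap t).1.2 \in feet A ap) /\ ((ap t).2 \in feet A ap).
Proof. by move=> tA; rewrite !inE; split; apply/orP; [left|right]; apply: imset_f. Qed.

(** If no triangle of [F] were flat, each would have a chosen triangle on an edge of [W]. A rich
    pair outside the at most [2 * q] feet then contradicts [rich_apex], whichever [t] contains
    [g]. *)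
Lemma some_flat : exists2 T, T \in F & flat T.
Proof.
case: (boolP [exists T in F, flat T]) => [/exists_inP[T]|/exists_inPn no]; first by exists T.
exfalso; have [ap hap] := choose_apex (subxx F) no.
have fW := feet_sub hap.
have [|a [a' [b [b' [[aW a'W aE a'E aa'] [[bW b'W bb'] [ab a'b ab' a'b']]]]]]] := rich_pair fW.
  by rewrite feet_card.
have := rich_apex NP rG pF Fk; rewrite -WE => /(_ _ _ _ _ aW a'W bW b'W aa' bb' ab a'b ab' a'b').
case=> g [t [_ tF _ _ h]]; have /and5P[xt uW vW xu /andP[xv uv]] := hap t tF.
have [uf vf] := feet_in ap tF.
have ne w w' : w \in feet F ap -> w' \notin feet F ap -> w != w'.
  by move=> wf; apply: contraNneq => <-.
by apply: (h _ _ _ xt uW vW uv xu xv); apply: ne.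
Qed.

(** * The unique flat triangle *)

Section OneFlat.
Variable T : {set V}.
Hypothesis TF : T \in F.
Hypothesis fT : flat T.
Variable ap : {set V} -> V * V * V.
Hypothesis hap : forall t, t \in F :\ T -> is_apex t (ap t).
Let E0 := feet (F :\ T) ap.

Lemma cardFT : q = (#|F :\ T|).+1.
Proof. by rewrite /q (cardsD1 T) TF. Qed.

(** As [a] and [a'] avoid the feet, [rich_apex] rules out every triangle of [F] other than [T] as
    the one containing [g]. *)
Lemma blocked (E : {set V}) : E0 \subset E -> E \subset W -> #|E| <= 2 * q ->
  exists g a a' b b', [/\ g \in G & g \subset T] /\
  [/\ a \in W, a' \in W, a \notin E & a' \notin E] /\ [/\ b \in W, b' \in W &
    b != b'] /\ ~~ gadj G b b' /\
  (forall F2, packing (G :\ g) F2 -> #|F2| = #|F| -> a \notin cover F2 -> a' \notin cover F2 ->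
     (b \notin cover F2) || (b' \notin cover F2) -> False).
Proof.
move=> E0E EW Ec.
have [a [a' [b [b' [[aW a'W aE a'E aa'] [[bW b'W bb'] [ab a'b ab' a'b']]]]]]] := rich_pair EW Ec.
have := rich_apex NP rG pF Fk; rewrite -WE => /(_ _ _ _ _ aW a'W bW b'W aa' bb' ab a'b ab' a'b').
case=> g [t [gG tF gt hF h]].
have tT : t = T.
  apply/eqP/negPn/negP => tT; have tFT : t \in F :\ T by rewrite in_setD1 tT.
  have /and5P[xt uW vW xu /andP[xv uv]] := hap tFT.
  have [uf vf] := feet_in ap tFT.
  have ne w w' : w \in E0 -> w' \notin E -> w != w'.
    by move=> wf; apply: contraNneq => <-; apply: (subsetP E0E).
  by apply: (h _ _ _ xt uW vW uv xu xv); apply: ne.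
subst t; exists g, a, a', b, b'; do 3!split=> //; split=> //.
by apply/negP => bb; apply: tfW aW bW b'W ab ab' bb.
Qed.

Lemma TW p w : p \in T -> w \in W -> w != p.
Proof. by move=> pT wW; apply: WF TF pT wW. Qed.

Lemma wT w : w \in W -> w \notin T.
Proof. by move=> wW; apply/negP => wT; have := TW wT wW; rewrite eqxx. Qed.

Lemma E0W : E0 \subset W. Proof. exact: feet_sub hap. Qed.

Lemma E0c : #|E0| <= 2 * #|F :\ T|. Proof. exact: feet_card. Qed.

(** If [g] were not the edge [pr], the triangle [prw] could replace [T]; since [w] is in [E], it
    misses [a] and [a']. The point is that one [g] serves all of [E]. *)
Lemma blocked_pair (E : {set V}) : E0 \subset E -> E \subset W -> #|E| <= 2 * q ->
  exists g : {set V}, forall p r w, p \in T -> r \in T -> p != r -> w \in E ->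
    gadj G p w -> gadj G r w -> g = [set p; r].
Proof.
move=> E0E EW Ec; have [g [a [a' [b [b' [[gG gT] [[aW a'W aE a'E] [[bW b'W bb'] [nbb h]]]]]]]]] :=
  blocked E0E EW Ec.
exists g => p r w pT rT pr wE pw rw; apply/eqP/negPn/negP => gpr.
have wW := subsetP EW _ wE.
have wg : w \notin g by apply: contraNN (wT wW); apply: (subsetP gT).
have g0 : g != set0 by rewrite -card_gt0; case: rG => -> .
have [pF0 cF0 vF0] := trans_packing pF TF (packing_delg pF TF gT g0).
have tpr : tri (G :\ g) [set p; r; w].
  apply: tri3; [|by apply: gadj_del; rewrite // wg orbT..].
  by apply: gadj_neqg (triP (packing_tri pF TF) pT rT pr) gpr.
have wc : w \notin cover F by move: wW; rewrite WE in_setC.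
have [|F1 [pF1 cF1 vF1]] := packing_push pF0 tpr.
  by rewrite vF0 disjoint3 !in_setD pT rT (negPf wc) andbF.
have aF s : s \in W -> s != w -> s \notin cover F1.
  move=> sW sw; rewrite vF1 vF0 in_setU in_setD !in_setU !in_set1 (negPf sw) (negPf (TW pT sW)) (negPf (TW rT sW)) /=.
  by move: sW; rewrite WE in_setC => /negPf->; rewrite andbF.
have aw s : s \notin E -> s != w by apply: contraNneq => ->.
apply: (h F1 pF1).
- by rewrite cF1.
- by apply: aF; rewrite ?aw.
- by apply: aF; rewrite ?aw.
have [bw|bw] := eqVneq b w; last by rewrite aF.
by rewrite [b' \notin _]aF ?orbT // -bw eq_sym.
Qed.

Lemma common_unique p r w p' r' w' : p \in T -> r \in T -> p != r -> w \in W -> gadj G p w ->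
  gadj G r w ->
  p' \in T -> r' \in T -> p' != r' -> w' \in W -> gadj G p' w' -> gadj G r' w' -> [set p;
    r] = [set p'; r'].
Proof.
move=> pT rT pr wW pw rw p'T r'T p'r' w'W p'w' r'w'.
(* There are at most [2 * (q - 1)] feet, which leaves room for the two vertices [w] and [w']. *)
have [|||g hg] := @blocked_pair (E0 :|: [set w; w']).
- exact: subsetUl.
- by rewrite subUset (E0W : _ \subset _) subUset !sub1set wW.
- apply: leq_trans (leq_card_setU _ _) _; have := E0c; have := cards2 w w'; have := cardFT.
  by case: (w != w') => /= -> ->; clear; lia.
have wE : w \in E0 :|: [set w; w'] by rewrite !inE eqxx orbT.
have w'E : w' \in E0 :|: [set w; w'] by rewrite !inE eqxx !orbT.
by rewrite -(hg p r w) // -(hg p' r' w').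
Qed.

(** Triangles are sorted by their number of vertices in [T]: none is excluded because [W] is
    triangle-free, one by flatness, two because the pair in [T] would have to be the deleted [xy],
    and three because [T] contains [xy]. *)
Lemma almost_trifree : exists x y, [/\ x \in T, y \in T & x != y] /\ trifree (G :\ [set x; y]) (W :|: T).
Proof.
have tT := packing_tri pF TF.
(* If no pair in [T] has a common neighbour in [W], any two vertices of [T] serve as [x] and [y]. *)
have [x [y [[xT yT xy] hxy]]] : exists x y, [/\ x \in T, y \in T & x != y] /\
    forall p r w, p \in T -> r \in T -> p != r -> w \in W -> gadj G p w -> gadj G r w -> [set p;
      r] = [set x; y].
  case: (boolP [exists x in T, exists y in T, exists w in W, [&& x != y, gadj G x w & gadj G y w]]).
    case/exists_inP => x xT /exists_inP[y yT /exists_inP[w wW /and3P[xy xw yw]]].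
    by exists x, y; split=> // p r s *; apply: (@common_unique _ _ s _ _ w).
  move/exists_inPn => no; have [x [y [z l]]] := tri_ex tT.
  have [xT yT _] := lab_in l; case: (l) => _ xy _ _; exists x, y; split=> // p r w pT rT pr wW pw rw.
  have /exists_inPn/(_ r rT)/exists_inPn/(_ w wW) := no p pT.
  by rewrite pr pw rw.
exists x, y; split=> //.
have del u v : gadj (G :\ [set x; y]) u v -> gadj G u v /\ [set u; v] != [set x; y].
  by rewrite /gadj !inE => /and3P[-> -> ->].
have two p r w : p \in T -> r \in T -> w \in W -> gadj (G :\ [set x; y]) p r ->
    gadj (G :\ [set x; y]) p w -> gadj (G :\ [set x; y]) r w -> False.
  move=> pT rT wW /del[pr /eqP h] /del[pw _] /del[rw _]; apply: h.
  by apply: hxy wW pw rw; rewrite ?(gadj_neq pr).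
have one p u v : p \in T -> u \in W -> v \in W -> gadj (G :\ [set x; y]) p u ->
    gadj (G :\ [set x; y]) p v -> gadj (G :\ [set x; y]) u v -> False.
  move=> pT uW vW /del[pu _] /del[pv _] /del[uv _]; have /forall_inP/(_ p pT)/indepP/(_ u v) := fT.
  by rewrite !in_nb uW vW pu pv uv => /(_ isT isT).
have inWT u : u \in W :|: T -> u \in W \/ u \in T by rewrite in_setU => /orP.
move=> p r s /inWT[pW|pT] /inWT[rW|rT] /inWT[sW|sT] pr ps rs.
- by have [[pr' _] [ps' _] [rs' _]] := And3 (del _ _ pr) (del _ _ ps) (del _ _ rs); apply:
  tfW pr' ps' rs'.
- by apply: (one s p r); rewrite // gadjC.
- by apply: (one r p s); rewrite // gadjC.
- by apply: (two r s p); rewrite // gadjC.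
- by apply: (one p r s).
- by apply: (two p s r); rewrite // gadjC.
- by apply: (two p r s).
have T3 : #|T| = 3 by case/andP: tT => /eqP.
have e : [set p; r; s] = T.
  apply/eqP; rewrite eqEcard !subUset !sub1set pT rT sT T3.
  by rewrite -setUA !cardsU1 cards1 !inE negb_or (gadj_neq pr) (gadj_neq ps) (gadj_neq rs).
have tt : tri (G :\ [set x; y]) T by rewrite -e; apply: tri3.
by have /del[_] := triP tt xT yT xy; rewrite eqxx.
Qed.

(* If s in T were adjacent to y and z, then yzs and the apex triangle of t could replace T and t,
   which blocks no edge inside T and so contradicts the exchange. *)
Lemma eo_T_le t x y z : t \in F :\ T -> x = (ap t).1.1 -> lab t x y z -> eo G t T <= 6.
Proof.
move=> tFT xE l; have /setD1P[tT tF] := tFT; have /and5P[_ uW vW xu /andP[xv uv]] := hap tFT.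
rewrite -{}xE in xu xv; have [uf vf] := feet_in ap tFT.
set u := (ap t).1.2 in uW xu uv uf; set v := (ap t).2 in vW xv uv vf.
have [xt yt zt] := lab_in l; have [xy xz yz] := lab_adj (packing_tri pF tF) l.
have nos s : s \in T -> gadj G s y -> gadj G s z -> False.
  move=> sT sy sz; have [|g [a [a' [b [b' [[gG gT] [[aW a'W aE a'E] [[bW b'W bb'] [nbb h]]]]]]]]] :=
    blocked (subxx E0) E0W.
    by have := E0c; have := cardFT => ->; clear; lia.
  have g0 : g != set0 by rewrite -card_gt0; case: rG => -> .
  have gF := packing_delg pF TF gT g0.
  have [pF0 cF0 vF0] := trans_packing pF TF gF.
  have [|pF1 cF1 vF1] := @trans_packing V (G :\ g) (G :\ g) _ t pF0 tFT.
    by move=> s' s'F _; apply: packing_tri pF0 s'F.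
  have nT p : p \in t -> p \notin T.
    by move=> pt; have := packing_disj pF tF TF tT; rewrite disjoints_subset => /subsetP/(_ p pt);
      rewrite in_setC.
  have ng p : p \notin T -> p \notin g by apply: contraNN; apply: (subsetP gT).
  have nW p : p \in W -> p \notin cover F by rewrite WE in_setC.
  have [||F2 [pF2 cF2 vF2]] := @packing_push V (G :\ g) _ [set y; z; s] pF1.
  - by apply: tri3; apply: gadj_del; rewrite ?(ng _ (nT _ yt)) ?(ng _ (nT _ zt)) // gadjC.
  - by rewrite vF1 vF0 disjoint3 !in_setD yt zt sT /= andbF.
  have [||F3 [pF3 cF3 vF3]] := @packing_push V (G :\ g) _ [set x; u; v] pF2.
  - by apply: tri3; apply: gadj_del; rewrite ?(ng _ (nT _ xt)) ?(ng _ (wT uW)).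
  - rewrite vF2 vF1 vF0 disjoint3 !in_setU !in_setD xt (negPf (nW _ uW)) (negPf (nW _ vW)) !andbF !in_set1 /= !orbF.
    rewrite (negPf (gadj_neq xy)) (negPf (gadj_neq xz)) /= (negPf (WF tF yt uW)) (negPf (WF tF zt uW)) (negPf (TW sT uW)).
    rewrite (negPf (WF tF yt vW)) (negPf (WF tF zt vW)) (negPf (TW sT vW)) !andbT.
    by apply: contraNneq (nT _ xt) => ->.
  have out p : p \in W -> p != u -> p != v -> p \notin cover F3.
    move=> pW pu pv; rewrite vF3 vF2 vF1 vF0 !in_setU !in_setD !in_set1 (negPf pu) (negPf pv) (negPf (nW _ pW)) !andbF.
    by rewrite (negPf (WF tF xt pW)) (negPf (WF tF yt pW)) (negPf (WF tF zt pW)) (negPf (TW sT pW)).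
  have aw p w : p \notin E0 -> w \in E0 -> p != w by move=> pE wE; apply: contraNneq pE => ->.
  apply: (h F3 pF3).
  - by rewrite cF3 cF2 cF1 cF0.
  - by apply: out => //; apply: aw.
  - by apply: out => //; apply: aw.
  (* As [b] and [b'] are not adjacent while [u] and [v] are, at least one of [b], [b'] stays outside
     the new packing. *)
  have [bu|bu] := eqVneq b u.
    rewrite [b' \notin _]out ?orbT // -?bu 1?eq_sym //.
    by apply: contraNneq nbb => <-; rewrite bu.
  have [bv|bv] := eqVneq b v; last by rewrite out.
  rewrite [b' \notin _]out ?orbT //; last by rewrite -bv eq_sym.
  by apply: contraNneq nbb => ->; rewrite bv gadjC.
rewrite eoC /eo; have T3 : #|T| = 3 by case/andP: (packing_tri pF TF) => /eqP.
have -> : 6 = \sum_(s in T) 2 by rewrite sum_nat_const T3.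
apply: leq_sum => s sT; rewrite (dg3 _ _ l); have := nos s sT.
by case: (gadj G s x) (gadj G s y) (gadj G s z) => [] [] [] // /(_ isT isT).
Qed.

(* If s in t' were adjacent to y and z, then yzs, xuv and the apex triangle of t' would replace t
   and t'. *)
Lemma eo_pair_le t t' x y z u v : t \in F -> t' \in F :\ T -> t != t' -> lab t x y z ->
  u \in W -> v \in W -> gadj G x u -> gadj G x v -> gadj G u v ->
  u \notin [set (ap t').1.2; (ap t').2] -> v \notin [set (ap t').1.2; (ap t').2] -> eo G t t' <= 7.
Proof.
move=> tF t'FT tt' l uW vW xu xv uv uD vD; have /setD1P[t'T t'F] := t'FT.
have /and5P[x't u'W v'W xu' /andP[xv' uv']] := hap t'FT.
move: x't u'W v'W xu' xv' uv' uD vD; set x' := (ap t').1.1; set u' := (ap t').1.2; set v' := (ap t').2.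
move=> x't u'W v'W xu' xv' uv'; rewrite !in_set2 !negb_or => /andP[uu' uv1] /andP[vu' vv'].
have [y' [z' l']] := tri_lab (packing_tri pF t'F) x't.
have [xt yt zt] := lab_in l; have [xy xz yz] := lab_adj (packing_tri pF tF) l.
have [_ y't z't] := lab_in l'; have [xy' xz' yz'] := lab_adj (packing_tri pF t'F) l'.
have nos s : s \in t' -> s != x' -> gadj G s y -> gadj G s z -> False.
  move=> st' sx' sy sz.
  have [|pF0 cF0 vF0] := @trans_packing V G G F t pF tF; first by move=> s' s'F _; apply:
    packing_tri pF s'F.
  have [||pF1 cF1 vF1] := @trans_packing V G G _ t' pF0.
  - by rewrite in_setD1 eq_sym tt'.
  - by move=> s' s'F _; apply: packing_tri pF0 s'F.
  have nt p : p \in t -> p \notin t'.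
    by move=> pt; have := packing_disj pF tF t'F tt'; rewrite disjoints_subset => /subsetP/(_ p pt);
      rewrite in_setC.
  have ne p p' : p \in t -> p' \in t' -> p != p'.
    by move=> pt p't; apply: contraNneq (nt _ pt) => ->.
  have nW p : p \in W -> p \notin cover F by rewrite WE in_setC.
  have [||F2 [pF2 cF2 vF2]] := @packing_push V G _ [set y; z; s] pF1.
  - by apply: tri3; rewrite // gadjC.
  - by rewrite vF1 vF0 disjoint3 !in_setD yt zt st' /= !andbF.
  have [||F3 [pF3 cF3 vF3]] := @packing_push V G _ [set x; u; v] pF2.
  - exact: tri3.
  - rewrite vF2 vF1 vF0 disjoint3 !in_setU !in_setD xt (negPf (nW _ uW)) (negPf (nW _ vW)) !andbF !in_set1 /= !orbF.
    rewrite (negPf (gadj_neq xy)) (negPf (gadj_neq xz)) /= (negPf (WF tF yt uW)) (negPf (WF tF zt uW)) (negPf (WF t'F st' uW)).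
    by rewrite (negPf (WF tF yt vW)) (negPf (WF tF zt vW)) (negPf (WF t'F st' vW)) !andbT ne.
  have [||F4 [pF4 cF4 vF4]] := @packing_push V G _ [set x'; u'; v'] pF3.
  - exact: tri3.
  - rewrite vF3 vF2 vF1 vF0 disjoint3 !in_setU !in_setD x't (negPf (nW _ u'W)) (negPf (nW _ v'W)) !andbF !in_set1 /= !orbF.
    rewrite (negPf (WF tF xt u'W)) (negPf (WF tF yt u'W)) (negPf (WF tF zt u'W)) (negPf (WF t'F st' u'W)).
    rewrite (negPf (WF tF xt v'W)) (negPf (WF tF yt v'W)) (negPf (WF tF zt v'W)) (negPf (WF t'F st' v'W)) !orbF /=.
    rewrite ![u' == _]eq_sym ![v' == _]eq_sym (negPf uu') (negPf uv1) (negPf vu') (negPf vv') !andbT !negb_or.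
    rewrite ![x' == _]eq_sym (negPf sx') (negPf (ne _ _ xt x't)) (negPf (ne _ _ yt x't)) (negPf (ne _ _ zt x't)).
    by rewrite (WF t'F x't uW) (WF t'F x't vW).
  by have := NP rG pF4; rewrite cF4 cF3 cF2 cF1 cF0 Fk ltnn.
rewrite eoC (dg_lab _ _ l') !(dg3 _ _ l).
have [_ x'y x'z _] := l'; have := nos y' y't; have := nos z' z't; rewrite ![_ == x']eq_sym x'y x'z.
case: (gadj G y' x) (gadj G y' y) (gadj G y' z) => [] [] [];
 case: (gadj G z' x) (gadj G z' y) (gadj G z' z) => [] [] [];
 case: (gadj G x' x) (gadj G x' y) (gadj G x' z) => [] [] [] // h1 h2.
all: by [case: (h1 isT isT isT) | case: (h2 isT isT isT)].
Qed.

(** The 18 is twice the 6 edges towards [T] plus the 6 ordered pairs inside [t]; each of the [q - 2]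
    other triangles accounts for 7. *)
Lemma per_triangle t : t \in F :\ T ->
  2 * (eo G t W + eo G t T) + \sum_(t' in F :\ T) eo G t t' <= 4 * N + 18 + 7 * (q - 2).
Proof.
move=> tFT; have /setD1P[tT tF] := tFT.
have /and5P[xt uW vW xu /andP[xv uv]] := hap tFT.
have [y [z l]] := tri_lab (packing_tri pF tF) xt.
have t3 s : s \in F -> #|s| = 3 by move=> /(packing_tri pF)/andP[/eqP].
rewrite (big_setD1 t) //=; have ett := eo_self_leq G t; rewrite t3 // in ett.
have eT := eo_T_le tFT erefl l.
have cF : q - 2 = #|F :\ T :\ t|.
  by have := cardFT; have := cardsD1 t (F :\ T); rewrite tFT => -> -> /=; rewrite add1n subn2.
have memF s : s \in F :\ T :\ t -> [/\ s \in F, s \in F :\ T & t != s].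
  by rewrite !in_setD1 eq_sym => /and3P[-> -> ->].
have bnd m : (forall s, s \in F :\ T :\ t -> eo G t s <= m) ->
    \sum_(s in F :\ T :\ t) eo G t s <= (q - 2) * m.
  by move=> h; rewrite cF -sum_nat_const; apply: leq_sum.
(* If the neighbourhood of the apex becomes independent without the feet of some [s], then [t] sends
   few edges to [W], and the saving pays for the trivial bound 9 on each other triangle. *)
case: (boolP [exists s in F :\ T :\ t, indep G (nb G W (ap t).1.1 :\: [set (ap s).1.2; (ap s).2])]).
  case/exists_inP => s sF iD; have [sF1 _ ts] := memF s sF.
  have sm := apex_small tF l uW vW uv xu xv _ iD.
  have {}sm : eo G t W <= N + al + 4 by apply: sm; rewrite cards2; case: (_ != _).
  have q3 : 3 <= q by have : 0 < q - 2; [rewrite cF; apply/card_gt0P; exists s|clear; lia].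
  have := num_al2 q3 hN al_leN eoW_lower eoWW.
  have := bnd 9; have h9 s' : s' \in F :\ T :\ t -> eo G t s' <= 9.
    by move=> /memF[s'F _ _]; have := eo_leq G t s'; rewrite !t3.
  move=> /(_ h9) {h9 bnd cF}; move: sm eT ett q2; rewrite -/N; clear.
  move: (eo G t W) (eo G t T) (eo G t t) (\sum_(i in _) _) => *; lia.
(* Now for every [s] the apex forms a triangle with an edge of [W] avoiding the feet of [s], as
   [eo_pair_le] requires. *)
move/exists_inPn => no.
have h7 s : s \in F :\ T :\ t -> eo G t s <= 7.
  move=> sF; have [sF1 sFT ts] := memF s sF.
  have /forall_inPn[u] := no s sF; rewrite in_setD in_nb => /and3P[uD u1 xu1] /forall_inPn[v].
  rewrite in_setD in_nb => /and3P[vD v1 xv1] /negPn uv1.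
  exact: eo_pair_le tF sFT ts l u1 v1 xu1 xv1 uv1 uD vD.
have := bnd 7 h7; have := eo2N tF; move: eT ett; clear.
move: (eo G t W) (eo G t T) (eo G t t) (\sum_(i in _) _) => *; lia.
Qed.

Lemma eo_del A x y : x != y -> eo G A A <= eo (G :\ [set x; y]) A A + 2.
Proof.
move=> xy.
have d p : dg G A p <= dg (G :\ [set x; y]) A p + ((p == x) + (p == y)).
  have s : nb G A p \subset nb (G :\ [set x; y]) A p :|: ((if p == x then [set y] else set0) :|:
    (if p == y then [set x] else set0)).
    apply/subsetP => w; rewrite !in_setU !in_nb => /andP[wA pw]; rewrite wA /=.
    have [e|e] := eqVneq [set x; y] [set p; w]; last by rewrite (gadj_neqg pw e).
    have wp := gadj_neq pw; have : p \in [set x; y] by rewrite e !inE eqxx.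
    have : w \in [set x; y] by rewrite e !inE eqxx orbT.
    by rewrite !inE => /orP[]/eqP wE /orP[]/eqP pE; rewrite wE pE ?eqxx in wp *;
      rewrite /= ?eqxx ?in_set1 ?eqxx ?orbT.
  apply: leq_trans (subset_leq_card s) _; apply: leq_trans (leq_card_setU _ _) _.
  rewrite leq_add2l; apply: leq_trans (leq_card_setU _ _) _.
  by apply: leq_add; case: ifP; rewrite ?cards1 ?cards0.
apply: leq_trans (leq_sum _ (fun p _ => d p)) _; rewrite big_split leq_add2l big_split /=.
have one r : \sum_(p in A) (p == r) <= 1.
  rewrite big_mkcond /=; apply: leq_trans (_ : \sum_p (p == r) <= 1).
    by apply: leq_sum => p _; case: ifP.
  by rewrite (bigD1 r) //= eqxx big1 // => p /negPf->.
by rewrite (leq_add (one x) (one y)).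
Qed.

(** Mantel bounds the edges inside [W :|: T] up to the one deleted edge, and [per_triangle] bounds
    all the others. *)
Lemma one_flat_false : False.
Proof.
have [x [y [[xT yT xy] tfWT]]] := almost_trifree.
have dWT : [disjoint W & T] by rewrite disjoints_subset; apply/subsetP => w; rewrite in_setC; apply: wT.
have cWT : #|W :|: T| = N + 3.
  have T3 : #|T| = 3 by case/andP: (packing_tri pF TF) => /eqP.
  by have := cardsUI W T; move: dWT; rewrite -setI_eq0 => /eqP->; rewrite cards0 addn0 T3.
have m1 := mantel tfWT; have m2 := eo_del (W :|: T) xy; rewrite cWT in m1.
have [trF _] := andP pF.
apply: (num_final q2 GE (X := eo G (W :|: T) (W :|: T))); last first.
  move: m1 m2; have [s sE] := sqrn_mod4 (N + 3); move: sE; clear; move: (eo _ _ _) (eo G _ _) => *; lia.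
have -> : 2 * #|G| = eo G (W :|: T) (W :|:
  T) + \sum_(t in F :\ T) (2 * (eo G t W + eo G t T) + \sum_(t' in F :\ T) eo G t t').
  have [G2 _] := rG; rewrite eo_card //.
  have pFT : packing G (F :\ T) by apply: packing_sub pF (subsetDl _ _) _ => t /setD1P[_]; apply:
    packing_tri pF.
  have eoF A : eo G (cover (F :\ T)) A = \sum_(t in F :\ T) eo G t A.
    by rewrite /eo big_trivIset //; case/andP: pFT.
  have sT : setT = (W :|: T) :|: cover (F :\ T).
    apply/setP => p; rewrite cover_del // !in_setU in_setD WE in_setC in_setT.
    by case: (p \in T); case: (p \in cover F).
  have d : [disjoint W :|: T & cover (F :\ T)].
    rewrite disjoints_subset; apply/subsetP => p;
      rewrite cover_del // in_setU in_setC in_setD WE in_setC.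
    by case: (p \in T); case: (p \in cover F).
  have e1 : \sum_(t in F :\ T) eo G t (W :|: T) = \sum_(t in F :\ T) (eo G t W + eo G t T).
    by apply: eq_bigr => t _; apply: eoUr.
  have e2 : eo G (cover (F :\ T)) (cover (F :\ T)) = \sum_(t in F :\ T) \sum_(s in F :\ T) eo G t s.
    by rewrite eoF; apply: eq_bigr => t _; rewrite eoC eoF; apply: eq_bigr => s _; rewrite eoC.
  rewrite big_split /= -big_distrr /= -e1 -e2 -eoF sT eoUl // eoUr // (eoUr _ (cover _) d) (eoC G (W :|: T) (cover _)).
  by rewrite mul2n -addnn !addnA.
rewrite leq_add2l; apply: leq_trans (leq_sum _ per_triangle) _.
by rewrite sum_nat_const cardFT subn1.
Qed.

End OneFlat.

Lemma maximal_false : False.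
Proof.
have [T TF fT] := some_flat.
have [||ap hap] := @choose_apex (F :\ T); first exact: subsetDl.
  move=> t /setD1P[tT tF]; apply: contraNN tT => ft; apply/eqP; exact: one_flat.
exact: one_flat_false TF fT ap hap.
Qed.

End Maximal.

(** * The induction on k *)

Lemma num_start k n b : 2 <= k -> 2 * k.+1 ^ 2 - k.+1 + 2 <= n -> 2 * b = 3 * k * (3 * k).-1 ->
  b <= (n - k.+1 + 2) ^ 2 %/ 4.
Proof.
move=> k2 hn hb; have h1 : 2 * (k * k) + 2 * k + 4 <= n - k.+1 + 2.
  by move: hn; rewrite expnS expn1; nia.
have h2 := leq_mul h1 h1; rewrite leq_divRL // expnS expn1; apply: leq_trans h2.
have h3 : 2 * k <= k * k by rewrite leq_mul2r k2 orbT.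
have : (3 * k).-1 = 3 * k - 1 by lia.
nia.
Qed.

(** A rainbow packing of [k] triangles would fit into a rainbow graph with exactly the critical
    number of edges, and a best packing of that graph contradicts [maximal_false]. *)
Lemma noP_step (V C : finType) (c : {set V} -> C) k n : 2 <= k -> #|V| = n ->
  2 * k.+1 ^ 2 - k.+1 + 2 <= n -> noP c k.+1 ->
  (n - k.+1 + 2) ^ 2 %/ 4 + (k.+1 - 2) * (n - k.+1 + 2) + 'C(k.+1 - 2, 2) + 2 <= ncol c ->
  noP c k.
Proof.
move=> k2 nV hn NP hc G0 F0 rG0 pF0; rewrite ltnNge; apply/negP => kF0.
have F0k : #|F0| = k by apply/eqP; rewrite eqn_leq kF0 -ltnS (NP _ _ rG0 pF0).
(* Keeping only the edges inside the cover leaves few enough of them, by [num_start], to extend to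
   exactly the critical number. *)
pose G1 := [set e in G0 | e \subset cover F0].
have sG1 : G1 \subset G0 by apply/subsetP => e; rewrite inE => /andP[].
have G1c : #|G1| <= 'C(3 * k, 2).
  rewrite -F0k -(packing_cover pF0) -cards_draws; apply: subset_leq_card.
  apply/subsetP => e; rewrite !inE => /andP[eG0 ->] /=; apply/eqP; exact: rG0.1.
have [G rG [sG Gc]] : exists2 G, rain c G & G1 \subset G /\
    #|G| = (n - k.+1 + 2) ^ 2 %/ 4 + (k.+1 - 2) * (n - k.+1 + 2) + 'C(k.+1 - 2, 2) + 2.
  apply: rain_ext; first exact: rain_sub sG1.
  rewrite hc andbT; apply: leq_trans G1c _.
  apply: leq_trans (num_start k2 hn (bin2_double _)) _; rewrite -!addnA; exact: leq_addr.
have pF0G : packing G F0.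
  apply: (packing_sub pF0 (subxx _)) => t tF; have tt := packing_tri pF0 tF.
  case/andP: (tt) => t3 _; rewrite /tri t3; apply/forall_inP => x xt; apply/forall_inP => y yt;
    apply/implyP => xy.
  have /andP[_ h] := triP tt xt yt xy; rewrite /gadj xy (subsetP sG) // inE h subUset !sub1set.
  by rewrite !(in_cover tF).
pose P := [pred F | packing G F & #|F| == k].
have P0 : P F0 by rewrite /= pF0G F0k eqxx.
case: (@arg_maxnP _ F0 P (fun F => eo G (~: cover F) (~: cover F)) P0) => F /andP[pF /eqP Fk] maxF.
have [I [IW iI maxI]] := max_indep G (~: cover F).
have W : #|~: cover F| = n - 3 * k by rewrite -[#|~:
  _|](addKn #|cover F|) cardsC nV (packing_cover pF) Fk.
have hN : 2 * k ^ 2 + 3 + 3 * k <= n by move: hn; rewrite !expnS !expn0; nia.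
apply: (maximal_false NP rG pF _ erefl _ IW iI maxI).
- by rewrite Fk.
- by move=> F' pF' F'k; apply: maxF; rewrite /= pF' F'k Fk eqxx.
- by rewrite Fk.
- by rewrite Fk W; move: hN; clear; lia.
rewrite Fk Gc W; have -> : n - k.+1 + 2 = n - 3 * k + 2 * k + 1 by move: hN; clear; lia.
by have -> : k.+1 - 2 = k - 1 by lia.
Qed.

Lemma ncol_bound k : 2 <= k -> forall (V C : finType) (c : {set V} -> C) n, #|V| = n ->
  2 * k ^ 2 - k + 2 <= n -> noP c k ->
  ncol c < (n - k + 2) ^ 2 %/ 4 + (k - 2) * (n - k + 2) + 'C(k - 2, 2) + 2.
Proof.
elim: k => // k IH k2 V C c n nV hn NP.
case: (ltnP k 2) => k2'.
  have k1 : k = 1 by move: k2 k2'; clear; lia.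
  subst k; have n8 : 8 <= n by [].
  rewrite subnn mul0n bin0n !addn0 subnK; last by apply: leq_trans n8.
  by apply: two_triangles nV NP; apply: leq_trans n8.
rewrite ltnNge; apply/negP => hc.
have NPk := noP_step k2' nV hn NP hc.
have hn' : 2 * k ^ 2 - k + 2 <= n by move: hn; rewrite !expnS !expn0; nia.
(* The bound for [k] is at most the bound for [k.+1], so the inductive bound contradicts [hc]. *)
have := IH k2' V C c n nV hn' NPk.
rewrite ltnNge => /negP; apply; apply: leq_trans hc.
have [p kE] : exists p, k = p + 2 by exists (k - 2); lia.
have [m nE] : exists m, n = k.+1 + m by exists (n - k.+1); move: hn; rewrite expnS expn1; nia.
have -> : n - k.+1 + 2 = m + 2 by lia.
have -> : n - k + 2 = m + 3 by lia.
have -> : k.+1 - 2 = p.+1 by lia.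
have -> : k - 2 = p by lia.
rewrite binS bin1 !leq_add2r.
suff : (m + 3) ^ 2 %/ 4 <= (m + 2) ^ 2 %/ 4 + (m + 2) by nia.
rewrite -divnDMl //; apply: leq_div2r; rewrite !expnS !expn0; nia.
Qed.

(** * Anti-Ramsey numbers *)

Lemma edges_complete n : edges (complete n) = [set e : {set complete n} | #|e| == 2].
Proof.
apply/setP => e; rewrite inE; apply/imsetP/cards2P => [[[x y] xy ->]|[x [y [xy ->]]]].
  by exists x, y; split=> //; rewrite inE in xy.
by exists (x, y); rewrite ?inE.
Qed.

Lemma num_colorsE n (C : finType) (c : coloring (complete n) C) : num_colors c = ncol c.
Proof. by rewrite /num_colors edges_complete. Qed.

Lemma kC3_edge k (i : 'I_k) (j j' : 'I_3) : j != j' ->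
  [set ((i, j) : kC3 k); (i, j')] \in edges (kC3 k).
Proof.
move=> jj'; apply/imsetP; exists (((i, j) : kC3 k), ((i, j') : kC3 k)) => //.
by rewrite inE /= /copies_adj eqxx.
Qed.

(** * From packings to copies of kC3 *)

Section RainbowTriangles.
Variables (k n : nat) (C : finType) (c : coloring (complete n) C) (G F : {set {set complete n}}).
Hypotheses (rG : rain c G) (pF : packing G F) (kF : k <= #|F|) (v0 : 'I_n).

Let T (i : 'I_k) : {set complete n} := nth set0 (enum F) i.
Let f : {ffun kC3 k -> complete n} := [ffun p : 'I_k * 'I_3 => nth v0 (enum (T p.1)) p.2].

Let TF i : T i \in F.
Proof. by rewrite -mem_enum mem_nth // -cardE (leq_trans (ltn_ord i)). Qed.

Let T3 i : size (enum (T i)) = 3.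
Proof. by rewrite -cardE; case/andP: (packing_tri pF (TF i)) => /eqP. Qed.

Let fT p : f p \in T p.1.
Proof. by rewrite ffunE -mem_enum mem_nth // T3. Qed.

Let fI : injective f.
Proof.
move=> [i j] [i' j'] E; have ii' : i = i'.
  apply: val_inj; apply/eqP; rewrite -(nth_uniq set0 (s :=
    enum F)) ?enum_uniq // -?cardE ?(leq_trans (ltn_ord _)) //.
  apply/negPn/negP => ne; have := packing_disj pF (TF i) (TF i') ne.
  by rewrite disjoints_subset => /subsetP/(_ _ (fT (i, j))); rewrite in_setC E (fT (i', j')).
subst i'; congr (_, _); apply: val_inj; apply/eqP.
rewrite -(nth_uniq v0 (s := enum (T i))) ?enum_uniq ?T3 ?ltn_ord //.
by move: E; rewrite !ffunE /= => E; apply/eqP.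
Qed.

Lemma packing_rainbow : has_rainbow (kC3 k) c.
Proof.
apply/existsP; exists f; apply/and3P; split; first exact/injectiveP.
  apply/forallP => x; apply/forallP => y; apply/implyP => /andP[_ xy].
  rewrite /= /complete_adj (inj_eq fI); apply: contraTneq xy => ->.
  by rewrite adj_irrefl.
have fG e : e \in edges (kC3 k) -> f @: e \in G.
  case/imsetP => [[x y]]; rewrite inE /= => /andP[/eqP xy1 xy] ->.
  have xy' : f x != f y by rewrite (inj_eq fI); apply: contraTneq xy => ->; rewrite adj_irrefl.
  have := triP (packing_tri pF (TF x.1)) (fT x) _ xy'; rewrite xy1 => /(_ (fT y)) /andP[_].
  by rewrite imsetU1 imset_set1.
apply/dinjectiveP => e e' eE e'E cee'; apply: (imset_inj fI).
by apply: rG.2 cee'; apply: fG.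
Qed.

End RainbowTriangles.

Lemma ar_upper k n : 2 <= k -> 2 * k ^ 2 - k + 2 <= n ->
  ar n (kC3 k) <= (n - k + 2) ^ 2 %/ 4 + (k - 2) * (n - k + 2) + 'C(k - 2, 2) + 1.
Proof.
move=> k2 hn; apply/bigmax_leqP => c nr.
have v0 : 'I_n by apply: (@Ordinal n 0); apply: leq_trans hn; rewrite addn2.
rewrite num_colorsE -ltnS -addnS; apply: (ncol_bound k2) => //; first exact: card_ord.
move=> G F rG pF; rewrite ltnNge; apply: contraNN nr => kF.
exact: packing_rainbow rG pF kF v0.
Qed.

(** * The extremal colouring *)

Section LowerBound.
Variables (k n : nat).
Hypotheses (k2 : 2 <= k) (kn : k + 2 <= n).
Let m := n - k + 2.
Let V : finType := complete n.
Let low (a : nat) : {set V} := [set x : 'I_n | x < a].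
(** [P] carries the complete graph on [k - 2] vertices; [B] and [D] are the two sides of the
    balanced complete bipartite graph on the other [m] vertices. *)
Let P := low (k - 2).
Let L := low (k - 2 + m %/ 2).
Let B := L :\: P.
Let D := ~: L.

Let H : {set {set V}} := [set e : {set V} | [&& #|e| == 2, ~~ (e \subset B) & ~~ (e \subset D)]].
(** [None] is the one further colour, shared by all edges inside [B] or inside [D]. *)
Let c : coloring (complete n) (option {set V}) := [ffun e => if e \in H then Some e else None].

Let card_low a : a <= n -> #|low a| = a.
Proof.
move=> an; have -> : low a = [set widen_ord an i | i : 'I_a].
  apply/setP => x; rewrite inE; apply/idP/imsetP => [xa|[i _ ->] /=].
    by exists (Ordinal xa) => //; apply: val_inj.
  exact: ltn_ord.
by rewrite card_imset ?card_ord // => i j /(congr1 val) /= /val_inj.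
Qed.

Let nE : n = k - 2 + m. Proof. by rewrite /m; lia. Qed.
Let cP : #|P| = k - 2. Proof. by apply: card_low; lia. Qed.
Let PL : P \subset L. Proof. by apply/subsetP => x; rewrite !inE; lia. Qed.
Let cL : #|L| = k - 2 + m %/ 2. Proof. by apply: card_low; lia. Qed.
Let cB : #|B| = m %/ 2.
Proof. by rewrite cardsD (setIidPr PL) cP cL addKn. Qed.
Let cD : #|D| = m - m %/ 2.
Proof. by have := cardsC L; rewrite cL card_ord /D; lia. Qed.
Let dBD : [disjoint B & D].
Proof. by rewrite disjoints_subset /D setCK subsetDl. Qed.
Let setT_PBD : [set: V] = P :|: (B :|: D).
Proof. by apply/setP => x; rewrite !inE; have := subsetP PL x; rewrite !inE; case: (_ < _) =>
  [->|_] //; rewrite ?orbT //; case: (_ < _). Qed.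
Let dP : [disjoint P & B :|: D].
Proof.
rewrite disjoints_subset; apply/subsetP => x xP; have := subsetP PL x xP.
by rewrite in_setC in_setU {1}/B in_setD xP /D in_setC negbK.
Qed.

Let HadjP x y : x \in P -> x != y -> gadj H x y.
Proof.
move=> xP xy; have := subsetP PL x xP => xL.
by rewrite /gadj xy inE cards2 xy !subUset !sub1set /B /D in_setD in_setC xP xL.
Qed.

Let HadjBD x y : x \in B -> y \in D -> gadj H x y.
Proof.
move=> xB yD; have xD : x \notin D by rewrite in_setC negbK; case/setDP: xB.
have yB : y \notin B by apply: contraTN yD => /setDP[yL _]; rewrite in_setC negbK.
have xy : x != y by apply: contraNneq yB => <-.
by rewrite /gadj xy inE cards2 xy !subUset !sub1set (negPf xD) (negPf yB) !andbF.
Qed.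

Let full (A A' : {set V}) : (forall x y, x \in A -> y \in A' -> gadj H x y) -> eo H A A' = #|A| * #|A'|.
Proof.
move=> h; rewrite -sum_nat_const; apply: eq_bigr => x xA; apply: eq_card => y.
by rewrite in_nb; case yA: (y \in A') => //=; apply: h.
Qed.

Lemma card_rainbow_part : m ^ 2 %/ 4 + (k - 2) * m + 'C(k - 2, 2) <= #|H|.
Proof.
have H2 e : e \in H -> #|e| = 2 by rewrite inE => /and3P[/eqP].
rewrite -(leq_pmul2l (isT : 0 < 2)) (eo_card H2) setT_PBD eoUl // !eoUr // !eoUl //.
have e1 : eo H P B = #|P| * #|B|.
  apply: full => x y xP yB; apply: HadjP => //; apply: contraTneq yB => <-.
  by rewrite in_setD xP.
have e2 : eo H P D = #|P| * #|D|.
  apply: full => x y xP yD; apply: HadjP => //; apply: contraTneq yD => <-.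
  by rewrite in_setC (subsetP PL).
have e3 : eo H B D = #|B| * #|D| by apply: full; apply: HadjBD.
have e4 : eo H P P = #|P| * #|P|.-1.
  rewrite -sum_nat_const; apply: eq_bigr => x xP; rewrite (cardsD1 x P) xP; apply: eq_card => y.
  rewrite in_nb in_setD1 andbC; case: eqVneq => [->|yx]; first by rewrite gadjxx.
  by rewrite HadjP // eq_sym.
rewrite (eoC H B P) (eoC H D P) (eoC H D B) e1 e2 e3 e4 cP cB cD.
have := bin2_double (k - 2); have [s sE] := sqrn_mod4 m.
have [h hE] : exists h, m = 2 * h \/ m = 2 * h + 1 by exists (m %/ 2); lia.
have : m ^ 2 %/ 4 = (m %/ 2) * (m - m %/ 2).
  case: hE => ->.
    have -> : 2 * h %/ 2 = h by lia.
    have -> : (2 * h) ^ 2 = h * h * 4 by rewrite expnS expn1; lia.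
    by rewrite mulnK //; congr (_ * _); lia.
  have -> : (2 * h + 1) %/ 2 = h by lia.
  have -> : (2 * h + 1) ^ 2 = h * h.+1 * 4 + 1 by rewrite expnS expn1; nia.
  by rewrite divnMDl // addn0; congr (_ * _); lia.
have : m = m %/ 2 + (m - m %/ 2) by lia.
move: (m %/ 2) (m - m %/ 2) (m ^ 2 %/ 4) => a b d mE -> {sE hE}; rewrite mE {mE}.
move: (k - 2) (k - 2).-1 'C(_, _) (eo H B B) (eo H D D) => ? ? ? ? ? h1; nia.
Qed.

Lemma lower_colors : #|H| + 1 <= num_colors c.
Proof.
have [x [y [xB yB xy]]] : exists x y, [/\ x \in B, y \in B & x != y].
  by apply: card_ge2P; rewrite cB /m; lia.
have N : None \notin [set Some e | e in H] by apply/imsetP => -[].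
rewrite num_colorsE /ncol; have <- : #|None |: [set Some e | e in H]| = #|H| + 1.
  by rewrite cardsU1 N card_imset 1?addnC // => a b [].
apply: subset_leq_card; rewrite subUset sub1set; apply/andP; split.
  apply/imsetP; exists [set x; y]; first by rewrite inE cards2 xy.
  by rewrite ffunE inE subUset !sub1set xB yB andbF.
apply/subsetP => _ /imsetP[e eH ->]; apply/imsetP; exists e; last by rewrite ffunE eH.
by move: eH; rewrite !inE => /and3P[].
Qed.

(** At most [k - 2] of the disjoint triangles meet [P], so two of them avoid it. Each of these has
    two vertices on the same side, [B] or [D], hence an edge coloured [None]. *)
Lemma lower_no_rainbow : ~~ has_rainbow (kC3 k) c.
Proof.
apply/negP => /existsP[f /and3P[/injectiveP fI _ /dinjectiveP cI]].
pose S := [set (p : kC3 k).1 | p in f @^-1: P].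
have cS : #|S| <= k - 2.
  rewrite -cP; apply: leq_trans (leq_imset_card _ _) _.
  rewrite -(card_imset _ fI); apply: subset_leq_card; apply/subsetP => y /imsetP[p]; rewrite inE =>
    h ->; exact: h.
have /card_ge2P[i [i' [iS i'S ii']]] : 1 < #|~: S| by have := cardsC S; rewrite card_ord; lia.
have mono r : r \in ~: S -> exists j j' : 'I_3, j != j' /\ c (f @: [set ((r, j) : kC3 k); (r,
  j')]) = None.
  rewrite in_setC => rS.
  have BD j : f (r, j) \notin D -> f (r, j) \in B.
    rewrite in_setC negbK in_setD => ->; rewrite andbT.
    by apply: contraNN rS => h; apply/imsetP; exists (r, j) => //; rewrite inE; exact: h.
  have ok j j' : (f (r, j) \in D) == (f (r, j') \in D) -> c (f @: [set ((r, j) : kC3 k); (r,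
    j')]) = None.
    move=> E; rewrite ffunE imsetU1 imset_set1 inE !subUset !sub1set; move: E (BD j) (BD j').
    by case: (_ \in D) => [] /eqP <- // => [_ _|/(_ isT)-> /(_ isT)->]; rewrite !andbF.
  pose o (a : nat) (h : a < 3) : 'I_3 := Ordinal h.
  case: (boolP ((f (r, @o 0 isT) \in D) == (f (r, @o 1 isT) \in D))) => [/ok h|h01].
    by exists (@o 0 isT), (@o 1 isT).
  case: (boolP ((f (r, @o 0 isT) \in D) == (f (r, @o 2 isT) \in D))) => [/ok h|h02].
    by exists (@o 0 isT), (@o 2 isT).
  exists (@o 1 isT), (@o 2 isT); split=> //; apply: ok.
  by move: h01 h02; do 3!case: (_ \in D).
have [j1 [j2 [j12 E]]] := mono i iS; have [j3 [j4 [j34 E']]] := mono i' i'S.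
have := cI _ _ (kC3_edge i j12) (kC3_edge i' j34); rewrite E E' => /(_ erefl)/setP/(_ (i, j1)).
by rewrite !inE eqxx /= !xpair_eqE (negPf ii').
Qed.

Lemma ar_lower : (n - k + 2) ^ 2 %/ 4 + (k - 2) * (n - k + 2) + 'C(k - 2, 2) + 1 <= ar n (kC3 k).
Proof.
apply: leq_trans (ar_max lower_no_rainbow); apply: leq_trans lower_colors.
by rewrite leq_add2r card_rainbow_part.
Qed.

End LowerBound.

Theorem theorem1p4 (k n : nat) (hk : 2 <= k) (hn : 2 * k ^ 2 - k + 2 <= n) :
  ar n (kC3 k) =
    (n - k + 2) ^ 2 %/ 4 + (k - 2) * (n - k + 2) + 'C(k - 2, 2) + 1.
Proof.
apply/eqP; rewrite eqn_leq ar_upper //= ar_lower //.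
by apply: leq_trans hn; rewrite leq_add2r expnS expn1; nia.
Qed.
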